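(* Define integer sequences $A(n)$, $B(n)$, $D(n)$ ($n\geq 0$) by the power series expansions, valid for $|q|<1$, \[ \sum_{n=0}^{\infty}A(n)q^{n}=\frac{(q^{2};q^{5})_{\infty}^{5}(q^{3};q^{5})_{\infty}^{5}}{(q;q^{5})_{\infty}^{5}(q^{4};q^{5})_{\infty}^{5}},\qquad \sum_{n=0}^{\infty}B(n)q^{n}=\frac{(q;q^{5})_{\infty}^{5}(q^{4};q^{5})_{\infty}^{5}}{(q^{2};q^{5})_{\infty}^{5}(q^{3};q^{5})_{\infty}^{5}}, \] \[ \sum_{n=0}^{\infty}D(n)q^{n}=\frac{(q^{5};q^{25})_{\infty}(q^{20};q^{25})_{\infty}}{(q^{10};q^{25})_{\infty}(q^{15};q^{25})_{\infty}}\cdot\frac{(q^{2};q^{5})_{\infty}^{5}(q^{3};q^{5})_{\infty}^{5}}{(q;q^{5})_{\infty}^{5}(q^{4};q^{5})_{\infty}^{5}}. \] Then $A(5n)<0$ and $B(5n)<0$ for all integers $n\geq 1$, and $D(5n+1)>0$ for all integers $n\geq 0$.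
   Context: For a complex number $a$ and $|q|<1$, $(a;q)_{\infty}:=\prod_{k=0}^{\infty}(1-aq^{k})$. (Equivalently, with $R(q)=q^{1/5}\frac{(q;q^5)_\infty(q^4;q^5)_\infty}{(q^2;q^5)_\infty(q^3;q^5)_\infty}$ the Rogers--Ramanujan continued fraction, the three series are $1/R^5(q)$, $R^5(q)$ and $R(q^5)/R^5(q)$.) *)

(* Defs.v *)
From HB Require Import structures.
From mathcomp Require Export all_boot all_order all_algebra.
From mathcomp Require Export all_classical all_reals all_analysis.
From mathcomp.real_closed Require Export complex.

Set Implicit Arguments.
Unset Strict Implicit.
Unset Printing Implicit Defensive.

Export Order.TTheory GRing.Theory Num.Theory.
Export numFieldNormedType.Exports.

Local Open Scope classical_set_scope.
Local Open Scope ring_scope.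

(* Both definitions are meant for K := R[i]; they are generic in K because the
   norm topology is attached to the numFieldType structure, not to the carrier
   type complex R. *)

(* (a; q)_oo.  [lim] is total; the partial products do converge when `|q| < 1. *)
Definition qpoch (K : numFieldType) (a q : K) : K :=
  lim ((fun n : nat => \prod_(k < n) (1 - a * q ^+ k)) @ \oo).

Definition is_qexpansion (K : numFieldType) (c : nat -> int) (F : K -> K) :=
  forall q : K, `|q| < 1 ->
    series (fun n : nat => (c n)%:~R * q ^+ n) @ \oo --> F q.

(* Main.v *)
From HB Require Import structures.
Require Import Defs.
From mathcomp Require Import ring zify.

(* Work in K[[q]] with f = (q,q^4;q^5)/(q^2,q^3;q^5) and g = 1/f, so that the
   three series are g^5, f^5 and f(q^5) g^5.  Write E_k = (q^k;q^k) and
   e = E_5/E_1.  By the Jacobi triple product E_1 E_5 is a double theta series;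
   multiplication by a Gaussian integer of norm 5 splits it into five cosets,
   two of which cancel, and this gives E_1 = E_25 (g(q^5) - q - q^2 f(q^5)).
   The product of this identity over q -> zeta q, zeta^5 = 1, gives
   E_1^6 = E_5^6 (g^5 - 11 q - q^2 f^5).  Together they say that f^5 is a root
   of a quadratic equation over the field generated by q and v = q f(q^5), whose
   other root has a pole, so f^5 is explicit:
     q f^5 = v (1 - 2v + 4v^2 - 3v^3 + v^4) / (1 + 3v + 4v^2 + 2v^3 + v^4).
   Since v^k only involves exponents congruent to k mod 5, the sections can be
   read off:
     sum A(5n) q^n   = g - 25 q g e^6,
     sum B(5n) q^n   = f - 25 q f e^6,
     sum D(5n+1) q^n = 5 f + 15 q f e^6 + 5 q^2 (f e)^6.
   Here f e and g e are products of factors 1/(1 - q^m), the coefficients of f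
   and g are bounded by those of e, and e - 1 <= q e / (1 - q) coefficientwise,
   which gives the signs.
   The coefficients in the theorem are those of the formal series because both
   are the asymptotic expansion at q = 0 of the same function, which is
   unique. *)

Set Implicit Arguments.
Unset Strict Implicit.
Unset Printing Implicit Defensive.

Local Open Scope ring_scope.

(** * Formal power series *)

Record fps (K : Type) := Fps { fcoef : nat -> K }.

Lemma fpsP (K : Type) (f g : fps K) : fcoef f =1 fcoef g -> f = g.
Proof. by case: f g => [f] [g] /= /funext ->. Qed.

HB.instance Definition _ (K : Type) := gen_eqMixin (fps K).
HB.instance Definition _ (K : Type) := gen_choiceMixin (fps K).

Section FpsRing.
Variable K : comNzRingType.
Implicit Types (f g h : fps K) (N n : nat).

Definition fps_const (c : K) := Fps (fun n => if n == 0%N then c else 0).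
Definition fps_add f g := Fps (fun n => fcoef f n + fcoef g n).
Definition fps_opp f := Fps (fun n => - fcoef f n).
Definition fps_mul f g :=
  Fps (fun n => \sum_(i < n.+1) fcoef f i * fcoef g (n - i)%N).

Definition fps_trunc N f : {poly K} := \poly_(i < N) fcoef f i.

Lemma coef_fps_trunc N f i : (i < N)%N -> (fps_trunc N f)`_i = fcoef f i.
Proof. by move=> iN; rewrite coef_poly iN. Qed.

Lemma fcoef_mul_trunc N f g n : (n < N)%N ->
  fcoef (fps_mul f g) n = (fps_trunc N f * fps_trunc N g)`_n.
Proof.
move=> nN; rewrite coefM /=; apply: eq_bigr => i _.
by rewrite !coef_fps_trunc //; have := ltn_ord i; lia.
Qed.

Lemma fps_addA : associative fps_add.
Proof. by move=> f g h; apply: fpsP => n /=; rewrite addrA. Qed.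

Lemma fps_addC : commutative fps_add.
Proof. by move=> f g; apply: fpsP => n /=; rewrite addrC. Qed.

Lemma fps_add0r : left_id (fps_const 0) fps_add.
Proof. by move=> f; apply: fpsP => n /=; rewrite if_same add0r. Qed.

Lemma fps_addNr : left_inverse (fps_const 0) fps_opp fps_add.
Proof. by move=> f; apply: fpsP => n /=; rewrite if_same addNr. Qed.

HB.instance Definition _ := GRing.isZmodule.Build (fps K)
  fps_addA fps_addC fps_add0r fps_addNr.

Lemma fps_mulC : commutative fps_mul.
Proof.
by move=> f g; apply: fpsP => n; rewrite !(@fcoef_mul_trunc n.+1) // mulrC.
Qed.

Lemma fps_mulA : associative fps_mul.
Proof.
move=> f g h; apply: fpsP => n; rewrite !(@fcoef_mul_trunc n.+1) //.
transitivity (fps_trunc n.+1 f * fps_trunc n.+1 g * fps_trunc n.+1 h)`_n.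
  rewrite -mulrA !coefM; apply: eq_bigr => i _; congr (_ * _).
  have in1 : (n - i < n.+1)%N by lia.
  by rewrite coef_fps_trunc // (@fcoef_mul_trunc n.+1).
rewrite !coefM; apply: eq_bigr => i _; congr (_ * _).
by rewrite coef_fps_trunc // (@fcoef_mul_trunc n.+1).
Qed.

Lemma fps_mul1r : left_id (fps_const 1) fps_mul.
Proof.
move=> f; apply: fpsP => n /=.
by rewrite big_ord_recl /= mul1r subn0 big1 ?addr0 // => i _; rewrite mul0r.
Qed.

Lemma fps_mulDl : left_distributive fps_mul fps_add.
Proof.
move=> f g h; apply: fpsP => n /=.
by rewrite -big_split /=; apply: eq_bigr => i _; rewrite mulrDl.
Qed.

Lemma fps_1neq0 : fps_const 1 != fps_const 0.
Proof.
by apply/eqP => /(congr1 (fun f => fcoef f 0)) /= /eqP; rewrite oner_eq0.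
Qed.

HB.instance Definition _ := GRing.Zmodule_isComNzRing.Build (fps K)
  fps_mulA fps_mulC fps_mul1r fps_mulDl fps_1neq0.

Lemma fps_constB : {morph fps_const : x y / x - y}.
Proof. by move=> x y; apply: fpsP => n /=; case: ifP; rewrite ?subr0. Qed.

Lemma fps_constM : {morph fps_const : x y / x * y}.
Proof.
move=> x y; apply: fpsP => n; rewrite [RHS]/= big_ord_recl /= subn0.
rewrite big1 ?addr0; last by move=> i _; rewrite mul0r.
by case: n => // n; rewrite mulr0.
Qed.

HB.instance Definition _ :=
  GRing.isZmodMorphism.Build K (fps K) fps_const fps_constB.
HB.instance Definition _ :=
  GRing.isMonoidMorphism.Build K (fps K) fps_const (conj erefl fps_constM).

Lemma fcoef1 n : fcoef (1 : fps K) n = (n == 0%N)%:R.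
Proof. by rewrite /=; case: ifP. Qed.

Lemma fcoef0 n : fcoef (0 : fps K) n = 0.
Proof. by rewrite /= if_same. Qed.

Lemma fcoefD f g n : fcoef (f + g) n = fcoef f n + fcoef g n.
Proof. by []. Qed.

Lemma fcoefN f n : fcoef (- f) n = - fcoef f n.
Proof. by []. Qed.

Lemma fcoefB f g n : fcoef (f - g) n = fcoef f n - fcoef g n.
Proof. by []. Qed.

Lemma fcoefMn f m n : fcoef (f *+ m) n = fcoef f n *+ m.
Proof. by elim: m => [|m IHm]; rewrite ?fcoef0 // !mulrS fcoefD IHm. Qed.

Lemma fcoef_sum (I : Type) (r : seq I) (P : pred I) (F : I -> fps K) n :
  fcoef (\sum_(i <- r | P i) F i) n = \sum_(i <- r | P i) fcoef (F i) n.
Proof. by elim/big_rec2: _ => [|i x y _ <-]; rewrite ?fcoef0 ?fcoefD. Qed.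

Lemma fcoefM f g n :
  fcoef (f * g) n = \sum_(i < n.+1) fcoef f i * fcoef g (n - i)%N.
Proof. by []. Qed.

Lemma fcoef_constM c f n : fcoef (fps_const c * f) n = c * fcoef f n.
Proof.
by rewrite fcoefM big_ord_recl subn0 big1 ?addr0 // => i _; rewrite /= mul0r.
Qed.

Lemma fcoef0M f g : fcoef (f * g) 0 = fcoef f 0 * fcoef g 0.
Proof. by rewrite fcoefM big_ord1. Qed.

Lemma fcoef0X f n : fcoef (f ^+ n) 0 = fcoef f 0 ^+ n.
Proof. by elim: n => [|n IHn]; rewrite ?fcoef1 // !exprS fcoef0M IHn. Qed.

Definition fpsX : fps K := Fps (fun n => (n == 1%N)%:R).

Lemma fcoefXM f n : fcoef (fpsX * f) n = if n is m.+1 then fcoef f m else 0.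
Proof.
rewrite fcoefM; case: n => [|n]; first by rewrite big_ord1 /= mul0r.
rewrite big_ord_recl /= mul0r add0r big_ord_recl /= mul1r big1 ?addr0.
  by rewrite /bump /= subn1.
by move=> i _; rewrite /bump /= mul0r.
Qed.

Lemma fcoefXnM f m n :
  fcoef (fpsX ^+ m * f) n = if (m <= n)%N then fcoef f (n - m)%N else 0.
Proof.
elim: m n => [|m IHm] n; first by rewrite expr0 mul1r subn0.
by rewrite exprS -mulrA fcoefXM; case: n => [|n] //; rewrite IHm.
Qed.

Lemma fcoefXn m n : fcoef (fpsX ^+ m) n = (n == m)%:R.
Proof.
rewrite -[fpsX ^+ m]mulr1 fcoefXnM fcoef1.
by case: ltngtP => // [nm|->]; rewrite ?subnn // eqn0Ngt subn_gt0 nm.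
Qed.

Lemma fpsXnI m : injective ( *%R (fpsX ^+ m)).
Proof.
move=> f g E; apply: fpsP => n; have := congr1 (fun h => fcoef h (m + n)) E.
by rewrite !fcoefXnM leq_addr addKn.
Qed.

End FpsRing.

Lemma fps_mulfI (K : idomainType) (f : fps K) :
  fcoef f 0 != 0 -> injective ( *%R f).
Proof.
move=> f0 g h fgh; apply: fpsP => n; elim/ltn_ind: n => n IHn.
have := congr1 (fun p => fcoef p n) fgh; rewrite !fcoefM !big_ord_recl !subn0.
rewrite [X in _ + X](eq_bigr (fun i : 'I_n =>
    fcoef f (lift ord0 i) * fcoef h (n - lift ord0 i)%N)).
  by move/addIr/(mulfI f0).
by move=> i _; rewrite IHn // ltn_subrL (leq_ltn_trans _ (ltn_ord i)).
Qed.

Section Congruence.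
Variable K : comNzRingType.
Implicit Types (f g h : fps K) (u v : nat -> fps K).

Definition eqmodX N f g := forall n, (n < N)%N -> fcoef f n = fcoef g n.

Lemma eqmodX_refl N f : eqmodX N f f. Proof. by []. Qed.

Lemma eqmodX_sym N f g : eqmodX N f g -> eqmodX N g f.
Proof. by move=> fg n /fg. Qed.

Lemma eqmodX_trans N f g h : eqmodX N f g -> eqmodX N g h -> eqmodX N f h.
Proof. by move=> fg gh n nN; rewrite fg // gh. Qed.

Lemma eqmodX_leq M N f g : (M <= N)%N -> eqmodX N f g -> eqmodX M f g.
Proof. by move=> MN fg n nM; apply: fg; apply: leq_trans MN. Qed.

Lemma eqmodX_eq f g : (forall N, eqmodX N.+1 f g) -> f = g.
Proof. by move=> fg; apply: fpsP => n; apply: fg (leqnn _). Qed.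

Lemma eqmodXD N f g f' g' :
  eqmodX N f f' -> eqmodX N g g' -> eqmodX N (f + g) (f' + g').
Proof. by move=> ff' gg' n nN; rewrite !fcoefD ff' // gg'. Qed.

Lemma eqmodXM N f g f' g' :
  eqmodX N f f' -> eqmodX N g g' -> eqmodX N (f * g) (f' * g').
Proof.
move=> ff' gg' n nN; rewrite !fcoefM; apply: eq_bigr => i _.
by have iN := ltn_ord i; rewrite ff' ?gg' //; lia.
Qed.

Lemma eqmodXXnM N c f g :
  eqmodX (N - c) f g -> eqmodX N (fpsX K ^+ c * f) (fpsX K ^+ c * g).
Proof.
by move=> fg n nN; rewrite !fcoefXnM; case: leqP => // cn; apply: fg; lia.
Qed.

Lemma eqmodX_sum N (I : Type) (r : seq I) (P : pred I) (F G : I -> fps K) :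
  (forall i, P i -> eqmodX N (F i) (G i)) ->
  eqmodX N (\sum_(i <- r | P i) F i) (\sum_(i <- r | P i) G i).
Proof. by move=> FG; elim/big_ind2: _ => // *; apply: eqmodXD. Qed.

Lemma eqmodX_prod N (I : Type) (r : seq I) (P : pred I) (F G : I -> fps K) :
  (forall i, P i -> eqmodX N (F i) (G i)) ->
  eqmodX N (\prod_(i <- r | P i) F i) (\prod_(i <- r | P i) G i).
Proof. by move=> FG; elim/big_ind2: _ => // *; apply: eqmodXM. Qed.

Definition convergent_factors u := forall k, eqmodX k.+1 (u k) 1.

Definition infprod u := Fps (fun n => fcoef (\prod_(k < n) u k) n).

Lemma eqmodX_infprod u M N : convergent_factors u -> (M <= N)%N ->
  eqmodX M.+1 (infprod u) (\prod_(k < N) u k).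
Proof.
move=> cu MN n nM; apply/esym; have: (n <= N)%N by lia.
elim: N {M MN nM} => [|N IHN]; first by case: n.
rewrite leq_eqVlt => /predU1P[->|nN] //; rewrite -IHN // big_ord_recr /=.
rewrite -[X in _ = fcoef X n]mulr1.
by apply: (@eqmodXM N.+1) => //; apply: cu.
Qed.

Lemma convergent_factorsM u v : convergent_factors u -> convergent_factors v ->
  convergent_factors (fun k => u k * v k).
Proof.
by move=> cu cv k; rewrite -[X in eqmodX _ _ X]mulr1; apply: eqmodXM.
Qed.

Lemma infprodM u v : convergent_factors u -> convergent_factors v ->
  infprod u * infprod v = infprod (fun k => u k * v k).
Proof.
move=> cu cv; apply: eqmodX_eq => N; apply/eqmodX_sym.
apply: eqmodX_trans (eqmodX_infprod (convergent_factorsM cu cv) (leqnn N)) _.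
by rewrite big_split; apply: eqmodXM; apply/eqmodX_sym/eqmodX_infprod.
Qed.

Lemma infprod1 : infprod (fun=> 1) = 1.
Proof. by apply: fpsP => n; rewrite [LHS]/= big1. Qed.

Lemma infprod_split m u : (0 < m)%N -> convergent_factors u ->
  infprod u = \prod_(i < m) infprod (fun k => u (i + m * k)%N).
Proof.
move=> m0 cu; apply: eqmodX_eq => N; apply/eqmodX_sym.
apply: (@eqmodX_trans _ _ (\prod_(i < m) \prod_(k < N) u (i + m * k)%N)).
  apply: eqmodX_prod => i _; apply: eqmodX_infprod => // k.
  by apply: eqmodX_leq (cu _); nia.
apply/eqmodX_sym.
suff <- : \prod_(k < N * m) u k = \prod_(i < m) \prod_(k < N) u (i + m * k)%N.
  by apply: eqmodX_infprod => //; nia.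
rewrite -(big_mkord xpredT u) big_nat_mul big_mkord exchange_big /=.
apply: eq_bigr => k _.
rewrite -{1}[(k * m)%N]add0n big_addn mulSn addnK big_mkord.
by apply: eq_bigr => i _; rewrite mulnC.
Qed.

Definition geo k := Fps (fun n => ((k %| n)%N%:R : K)).

Lemma mul1BXn_geo k : (0 < k)%N -> (1 - fpsX K ^+ k) * geo k = 1.
Proof.
move=> k0; apply: fpsP => n; rewrite mulrBl mul1r fcoefB fcoefXnM fcoef1 /=.
case: leqP => kn; last first.
  by case: n kn => [|n] kn; rewrite subr0 ?dvdn0 // gtnNdvd.
by rewrite dvdn_subl ?dvdnn // subrr; case: n kn => //; lia.
Qed.

End Congruence.

HB.lock Definition poch (K : comNzRingType) (a b : nat) : fps K :=
  infprod (fun k => 1 - fpsX K ^+ (a + b * k)).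

HB.lock Definition pochV (K : comNzRingType) (a b : nat) : fps K :=
  infprod (fun k => geo K (a + b * k)).

Section PochhammerSeries.
Variable K : comNzRingType.
Implicit Types (a b m : nat).
Local Notation geo := (geo K).
Local Notation poch := (poch K).
Local Notation pochV := (pochV K).

Lemma eqmodX_1BXn m : eqmodX m (1 - fpsX K ^+ m) 1.
Proof. by move=> n nm; rewrite fcoefB fcoefXn (ltn_eqF nm) subr0. Qed.

Lemma eqmodX_geo m : eqmodX m (geo m) 1.
Proof.
by move=> [|n] nm; rewrite fcoef1 /= ?dvdn0 // gtnNdvd.
Qed.

Lemma poch_convergent a b : (0 < a)%N -> (0 < b)%N ->
  convergent_factors (fun k => 1 - fpsX K ^+ (a + b * k)).
Proof. by move=> a0 b0 k; apply: eqmodX_leq (@eqmodX_1BXn _); nia. Qed.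

Lemma pochV_convergent a b : (0 < a)%N -> (0 < b)%N ->
  convergent_factors (fun k => geo (a + b * k)).
Proof. by move=> a0 b0 k; apply: eqmodX_leq (@eqmodX_geo _); nia. Qed.

Lemma eqmodX_poch a b N : (0 < a)%N -> (0 < b)%N ->
  eqmodX N.+1 (poch a b) (\prod_(k < N) (1 - fpsX K ^+ (a + b * k))).
Proof.
by move=> a0 b0; rewrite poch.unlock;
  apply: eqmodX_infprod (poch_convergent _ _) _.
Qed.

Lemma eqmodX_pochV a b N : (0 < a)%N -> (0 < b)%N ->
  eqmodX N.+1 (pochV a b) (\prod_(k < N) geo (a + b * k)).
Proof.
by move=> a0 b0; rewrite pochV.unlock;
  apply: eqmodX_infprod (pochV_convergent _ _) _.
Qed.

Lemma poch_pochV a b : (0 < a)%N -> (0 < b)%N -> poch a b * pochV a b = 1.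
Proof.
move=> a0 b0; rewrite poch.unlock pochV.unlock infprodM; first last.
- exact: pochV_convergent.
- exact: poch_convergent.
by rewrite -[RHS]infprod1; congr infprod; apply/funext => k;
  rewrite mul1BXn_geo //; lia.
Qed.

Lemma fcoef_poch0 a b : fcoef (poch a b) 0 = 1.
Proof. by rewrite poch.unlock [LHS]/= big_ord0 fcoef1. Qed.

Lemma fcoef_pochV0 a b : fcoef (pochV a b) 0 = 1.
Proof. by rewrite pochV.unlock [LHS]/= big_ord0 fcoef1. Qed.

Lemma poch_split m a b : (0 < m)%N -> (0 < a)%N -> (0 < b)%N ->
  poch a b = \prod_(i < m) poch (a + b * i) (b * m).
Proof.
move=> m0 a0 b0; rewrite poch.unlock (infprod_split m0) //;
  last exact: poch_convergent.
by apply: eq_bigr => i _; under eq_fun do rewrite mulnDr addnA mulnA.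
Qed.

End PochhammerSeries.

Section Substitutions.
Variable K : comNzRingType.
Implicit Types (f g : fps K) (m r n : nat) (z : K).
Local Notation X := (fpsX K).

Definition compXn m f :=
  Fps (fun n => if (m %| n)%N then fcoef f (n %/ m) else 0).

Definition dilate z f := Fps (fun n => z ^+ n * fcoef f n).

Definition msect m r f := Fps (fun n => fcoef f (m * n + r)).

Lemma fcoef_msect m r f n : fcoef (msect m r f) n = fcoef f (m * n + r).
Proof. by []. Qed.

Lemma compXnB m : {morph compXn m : f g / f - g}.
Proof.
by move=> f g; apply: fpsP => n /=; case: ifP => _ //; rewrite subr0.
Qed.

Lemma compXn1 m : compXn m 1 = 1.
Proof.
apply: fpsP => n; rewrite fcoef1 [LHS]/=; case: ifP => [/dvdnP[k ->]|].
  by case: m => [|m]; rewrite ?muln0 // mulnK // muln_eq0 orbF; case: ifP.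
by case: n => [|n]; rewrite ?dvdn0.
Qed.

Lemma compXnM m : {morph compXn m : f g / f * g}.
Proof.
move=> f g; apply: fpsP => n; case: m => [|m].
  rewrite fcoefM /= dvd0n; case: n => [|n]; first by rewrite !big_ord1.
  by rewrite [RHS]big1 // => -[[|i] iN] _; rewrite /= ?mul0r // mulr0.
have truncE h i : (i < n.+1)%N ->
    (fps_trunc n.+1 (compXn m.+1 h))`_i = (fps_trunc n.+1 h \Po 'X^(m.+1))`_i.
  move=> iN; rewrite coef_comp_poly_Xn // coef_fps_trunc //=; case: ifP => // _.
  by rewrite coef_fps_trunc // (leq_ltn_trans (leq_div _ _)).
rewrite [RHS](@fcoef_mul_trunc _ n.+1) // coefM.
transitivity ((fps_trunc n.+1 f \Po 'X^(m.+1)) *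
    (fps_trunc n.+1 g \Po 'X^(m.+1)))`_n.
  rewrite -comp_polyM coef_comp_poly_Xn //=; case: ifP => // _.
  by rewrite -(@fcoef_mul_trunc _ n.+1) // ltnS leq_div.
by rewrite coefM; apply: eq_bigr => i _; rewrite !truncE // ltnS leq_subr.
Qed.

HB.instance Definition _ m :=
  GRing.isZmodMorphism.Build (fps K) (fps K) (compXn m) (@compXnB m).
HB.instance Definition _ m :=
  GRing.isMonoidMorphism.Build (fps K) (fps K) (compXn m)
    (conj (compXn1 m) (@compXnM m)).

Lemma compXnI m : (0 < m)%N -> injective (compXn m).
Proof.
move=> m0 f g fg; apply: fpsP => n.
have := congr1 (fun h => fcoef h (m * n)) fg.
by rewrite /= dvdn_mulr // mulKn.
Qed.

Lemma fcoef_compXn0 m f : fcoef (compXn m f) 0 = fcoef f 0.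
Proof. by rewrite /= dvdn0 div0n. Qed.

Lemma compXnX m : (0 < m)%N -> compXn m X = X ^+ m.
Proof.
move=> m0; apply: fpsP => n; rewrite fcoefXn /=; case: ifP => [/dvdnP[k ->]|].
  by rewrite mulnK // -(@eqn_pmul2r m k 1) ?mul1n.
by case: eqP => // ->; rewrite dvdnn.
Qed.

Lemma eqmodX_compXn m N f g :
  eqmodX N f g -> eqmodX N (compXn m f) (compXn m g).
Proof.
by move=> fg n nN /=; case: ifP => // _; apply/fg/(leq_ltn_trans (leq_div _ _)).
Qed.

Lemma compXn_poch m a b : (0 < m)%N -> (0 < a)%N -> (0 < b)%N ->
  compXn m (poch K a b) = poch K (m * a) (m * b).
Proof.
move=> m0 a0 b0; apply: eqmodX_eq => N; apply/eqmodX_sym.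
have [ma0 mb0] : (0 < m * a)%N /\ (0 < m * b)%N by rewrite !muln_gt0 m0.
apply: eqmodX_trans (eqmodX_poch K ma0 mb0) _.
have := eqmodX_compXn m (@eqmodX_poch K a b N a0 b0).
move/eqmodX_sym; apply: eqmodX_trans.
rewrite rmorph_prod; apply: eqmodX_prod => k _.
by rewrite rmorphB rmorph1 rmorphXn /= compXnX // -exprM mulnDr mulnA.
Qed.

Lemma dilateB z : {morph dilate z : f g / f - g}.
Proof. by move=> f g; apply: fpsP => n /=; rewrite mulrBr. Qed.

Lemma dilate1 z : dilate z 1 = 1.
Proof. by apply: fpsP => -[|n] /=; rewrite ?mulr0 // mulr1. Qed.

Lemma dilateM z : {morph dilate z : f g / f * g}.
Proof.
move=> f g; apply: fpsP => n /=; rewrite mulr_sumr; apply: eq_bigr => i _.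
by rewrite mulrACA -exprD subnKC // -ltnS.
Qed.

HB.instance Definition _ z :=
  GRing.isZmodMorphism.Build (fps K) (fps K) (dilate z) (@dilateB z).
HB.instance Definition _ z :=
  GRing.isMonoidMorphism.Build (fps K) (fps K) (dilate z)
    (conj (dilate1 z) (@dilateM z)).

Lemma dilateX z : dilate z X = fps_const z * X.
Proof.
by apply: fpsP => n; rewrite fcoef_constM /=; case: eqP => [->|_];
  rewrite ?mulr0.
Qed.

Lemma dilate_compXn m z f : z ^+ m = 1 -> dilate z (compXn m f) = compXn m f.
Proof.
move=> zm; apply: fpsP => n /=; case: ifP => [/dvdnP[k ->]|_];
  last exact: mulr0.
by rewrite mulnC exprM zm expr1n mul1r.
Qed.

Lemma eqmodX_dilate z N f g : eqmodX N f g ->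
  eqmodX N (dilate z f) (dilate z g).
Proof. by move=> fg n nN /=; rewrite fg. Qed.

Lemma msectB m r : {morph msect m r : f g / f - g}.
Proof. by move=> f g; apply: fpsP. Qed.

HB.instance Definition _ m r :=
  GRing.isZmodMorphism.Build (fps K) (fps K) (msect m r) (@msectB m r).

Lemma sum_dvdn_ord m n (F : nat -> K) : (0 < m)%N ->
  \sum_(i < n.+1 | (m %| i)%N) F i = \sum_(j < (n %/ m).+1) F (m * j)%N.
Proof.
move=> m0; elim: n => [|n IHn].
  by rewrite div0n big_mkcond !big_ord1 dvdn0 muln0.
rewrite big_mkcond big_ord_recr -big_mkcond /= IHn divnS //.
case: (boolP (m %| n.+1)%N) => [mn|_]; last by rewrite addr0.
by rewrite [RHS]big_ord_recr /= -{1}(divnK mn) divnS // mn mulnC.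
Qed.

Lemma msect_compXnM m r f g : (r < m)%N ->
  msect m r (compXn m f * g) = f * msect m r g.
Proof.
move=> rm; have m0 : (0 < m)%N by lia.
apply: fpsP => n; rewrite [LHS]fcoefM [RHS]fcoefM.
rewrite (eq_bigr (fun i : 'I_(m * n + r).+1 => if (m %| i)%N then
   fcoef f (i %/ m) * fcoef g (m * n + r - i)%N else 0)); last first.
  by move=> i _; rewrite /=; case: ifP => // _; rewrite mul0r.
rewrite -big_mkcond (sum_dvdn_ord _
  (fun i => fcoef f (i %/ m) * fcoef g (m * n + r - i))) //.
rewrite [(m * n)%N]mulnC divnMDl // divn_small // addn0.
apply: eq_bigr => i _; rewrite mulKn //= [(n * m)%N]mulnC.
congr (_ * fcoef g _).
by have := ltn_ord i; nia.
Qed.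

Lemma msect_compXnMXn m r f k : (r < m)%N ->
  msect m r (compXn m f * X ^+ k) =
  if (k %% m == r)%N then f * X ^+ (k %/ m) else 0.
Proof.
move=> rm; rewrite msect_compXnM //; case: ifP => [/eqP <-|kr].
  congr (_ * _); apply: fpsP => n; rewrite [LHS]fcoefXn fcoefXn; congr _%:R.
  by rewrite {2}(divn_eq k m) eqn_add2r mulnC eqn_pmul2r //; lia.
suff -> : msect m r (X ^+ k) = 0 by rewrite mulr0.
apply: fpsP => n; rewrite fcoef0 [LHS]fcoefXn; case: eqP => // nk.
by rewrite -nk mulnC modnMDl modn_small ?eqxx in kr.
Qed.

Lemma msect_sum_compXn m r f N (c : nat -> int) : (r < m)%N ->
  msect m r (\sum_(k < N) (X * compXn m f) ^+ k *~ c k) =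
  \sum_(k < N | (k %% m == r)%N) (f ^+ k * X ^+ (k %/ m)) *~ c k.
Proof.
move=> rm; rewrite raddf_sum [RHS]big_mkcond /=; apply: eq_bigr => k _.
rewrite raddfMz exprMn -(rmorphXn (compXn m)) /= [X ^+ _ * _]mulrC.
rewrite msect_compXnMXn //.
by case: ifP; rewrite ?mul0rz.
Qed.

End Substitutions.

(** * Generating series of weighted sets *)

Section GeneratingSeries.
Variable K : comNzRingType.
Implicit Types (S T : choiceType) (N n : nat).
Local Notation X := (fpsX K).

(* The series [\sum_x w x * X ^+ e x] when [e] has finite fibres; the sum over a
   fibre on which [w] has infinite support is 0. *)
Definition genser T (w : T -> K) (e : T -> nat) :=
  Fps (fun n => \sum_(x \in e @^-1` [set n]) w x).

Definition covers T (e : T -> nat) N (r : seq T) :=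
  uniq r /\ forall x, (e x < N)%N -> x \in r.

Definition locally_finite T (e : T -> nat) := forall N, exists r, covers e N r.

Lemma eqmodX_genser T (w : T -> K) e N (r : seq T) : covers e N r ->
  eqmodX N (genser w e) (\sum_(x <- r) fps_const (w x) * X ^+ e x).
Proof.
move=> [r_uniq rN] n nN; rewrite fcoef_sum [LHS]/=.
under [RHS]eq_bigr do rewrite fcoef_constM fcoefXn eq_sym mulr_natr mulrb.
rewrite -[RHS]big_mkcond -[RHS]big_filter; apply: fsbig_fwiden;
  rewrite ?filter_uniq //.
  by move=> x /= xn; rewrite mem_filter xn eqxx rN // xn.
by move=> x [/=]; rewrite mem_filter => /andP[/eqP].
Qed.

Lemma eq_genser T (w w' : T -> K) e e' :
  w =1 w' -> e =1 e' -> genser w e = genser w' e'.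
Proof. by move=> /funext -> /funext ->. Qed.

Lemma genser_reindex S T (h : S -> T) (w : T -> K) e : bijective h ->
  genser w e = genser (w \o h) (e \o h).
Proof.
move=> h_bij; apply: fpsP => n; apply: reindex_fsbig; split => //.
  by move=> x y _ _; apply: bij_inj.
by case: h_bij => k hK kK y ey; exists (k y); rewrite /= ?kK.
Qed.

Lemma coversD S T (e : S -> nat) (e' : T -> nat) N r r' :
  covers e N r -> covers e' N r' ->
  covers (fun x => e x.1 + e' x.2)%N N [seq (x, y) | x <- r, y <- r'].
Proof.
move=> [r_uniq rN] [r'_uniq rN']; split.
  by apply: allpairs_uniq => // -[? ?] [? ?].
by move=> [x y] /= xyN; apply: allpairs_f; [apply: rN|apply: rN']; lia.
Qed.

Lemma locally_finiteD S T (e : S -> nat) (e' : T -> nat) :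
  locally_finite e -> locally_finite e' ->
  locally_finite (fun x => e x.1 + e' x.2)%N.
Proof.
move=> fe fe' N; have [r rN] := fe N; have [r' rN'] := fe' N.
by exists [seq (x, y) | x <- r, y <- r']; apply: coversD.
Qed.

Lemma genserM S T (w : S -> K) e (w' : T -> K) e' :
  locally_finite e -> locally_finite e' ->
  genser w e * genser w' e' =
  genser (fun x => w x.1 * w' x.2) (fun x => e x.1 + e' x.2)%N.
Proof.
move=> fe fe'; apply: eqmodX_eq => N.
have [r rN] := fe N.+1; have [r' rN'] := fe' N.+1.
apply: eqmodX_trans (eqmodXM (eqmodX_genser _ rN) (eqmodX_genser _ rN')) _.
apply/eqmodX_sym; rewrite mulr_suml.
apply: eqmodX_trans (eqmodX_genser _ (coversD rN rN')) _.
suff -> : \sum_(z <- [seq (x, y) | x <- r, y <- r'])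
      fps_const (w z.1 * w' z.2) * X ^+ (e z.1 + e' z.2) =
    \sum_(x <- r) fps_const (w x) * X ^+ e x *
      (\sum_(y <- r') fps_const (w' y) * X ^+ e' y) by [].
rewrite big_allpairs; apply: eq_bigr => x _; rewrite mulr_sumr.
by apply: eq_bigr => y _; rewrite fps_constM exprD mulrACA.
Qed.

Lemma genserXn T (w : T -> K) e c :
  X ^+ c * genser w e = genser w (fun x => c + e x)%N.
Proof.
apply: fpsP => n; rewrite fcoefXnM /=; case: leqP => cn.
  by apply: eq_fsbigl; apply/seteqP; split => x /=; lia.
by rewrite fsbig1 // => x /=; lia.
Qed.

Lemma compXn_genser T (w : T -> K) e m : (0 < m)%N ->
  compXn m (genser w e) = genser w (fun x => m * e x)%N.
Proof.
move=> m0; apply: fpsP => n /=; case: ifP => [/dvdnP[k ->]|mn].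
  rewrite mulnK //; apply: eq_fsbigl; apply/seteqP; split => x /=.
    by move=> ->; rewrite mulnC.
  by move/eqP; rewrite mulnC eqn_pmul2r // => /eqP.
by rewrite fsbig1 // => x /= mx; rewrite -mx dvdn_mulr in mn.
Qed.

Lemma genser_cosets m S T (h : 'I_m -> S -> T) (w : T -> K) e :
  bijective (fun z => h z.1 z.2) -> locally_finite e ->
  genser w e = \sum_(i < m) genser (w \o h i) (e \o h i).
Proof.
move=> h_bij fe; case: (h_bij) => k hK kK.
apply: eqmodX_eq => N; have [r [r_uniq rN]] := fe N.+1.
pose s := undup [seq (k y).2 | y <- r].
have sN i : covers (e \o h i) N.+1 s.
  split=> [|x /rN ixr]; rewrite ?undup_uniq // mem_undup.
  by apply/mapP; exists (h i x); rewrite // (hK (i, x)).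
rewrite (genser_reindex _ _ h_bij); apply/eqmodX_sym.
apply: (@eqmodX_trans _ _ _
    (\sum_(i < m) \sum_(x <- s) fps_const (w (h i x)) * X ^+ e (h i x))).
  by apply: eqmodX_sum => i _; apply: eqmodX_genser (sN i).
rewrite -big_enum -(big_allpairs
  (F := fun z => fps_const (w (h z.1 z.2)) * X ^+ e (h z.1 z.2))).
apply/eqmodX_sym/eqmodX_genser; split.
  by apply: allpairs_uniq => [||[? ?] [? ?]] //; rewrite ?enum_uniq ?undup_uniq.
by move=> [i x] /(sN i).2 xs; apply: allpairs_f; rewrite ?mem_enum.
Qed.

End GeneratingSeries.

Lemma genserZ (K : idomainType) (T : choiceType) (c : K) (w : T -> K) e :
  genser (fun x => c * w x) e = fps_const c * genser w e.
Proof. by apply: fpsP => n; rewrite fcoef_constM /= mulr_fsumr. Qed.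

Lemma genser_antisym (K : numDomainType) (T : choiceType) (h : T -> T)
    (w : T -> K) e : involutive h ->
  (forall x, w (h x) = - w x) -> (forall x, e (h x) = e x) -> genser w e = 0.
Proof.
move=> hK wh eh; have := genser_reindex w e (inv_bij hK).
have -> : w \o h = (fun x => -1 * w x).
  by apply/funext => x; rewrite /= wh mulN1r.
have -> : e \o h = e by apply/funext.
rewrite genserZ rmorphN1 mulN1r => w_opp; apply: fpsP => n; apply/eqP.
by rewrite fcoef0 -[_ == 0](mulrn_eq0 _ 2) mulr2n {1}w_opp fcoefN addNr.
Qed.

(** * The Jacobi triple product *)

Section GaussianBinomial.
Variables (A : comNzRingType) (y : A).
Implicit Types m n j : nat.

Fixpoint qbin n j : A :=
  match n, j with
  | _, 0 => 1
  | 0, _.+1 => 0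
  | n'.+1, j'.+1 => qbin n' j' + y ^+ j'.+1 * qbin n' j'.+1
  end.

Arguments qbin : simpl never.

Definition qfact n : A := \prod_(k < n) (1 - y ^+ k.+1).

Lemma qbin0 n : qbin n 0 = 1. Proof. by case: n. Qed.

Lemma qbinS n j : qbin n.+1 j.+1 = qbin n j + y ^+ j.+1 * qbin n j.+1.
Proof. by []. Qed.

Lemma qbin_small n j : (n < j)%N -> qbin n j = 0.
Proof.
elim: n j => [|n IHn] [|j] // nj.
by rewrite qbinS !IHn ?mulr0 ?addr0 //; lia.
Qed.

Lemma qfact0 : qfact 0 = 1. Proof. exact: big_ord0. Qed.

Lemma qfactS n : qfact n.+1 = qfact n * (1 - y ^+ n.+1).
Proof. exact: big_ord_recr. Qed.

Lemma qbin_qfact m j : qbin (m + j) j * qfact j * qfact m = qfact (m + j).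
Proof.
move mjn: (m + j)%N => n; elim: n m j mjn => [|n IHn] [|m] [|j] mjn; try lia.
- by rewrite qbin0 !qfact0 !mulr1.
- have jn : j = n by lia.
  rewrite qbinS (qbin_small (_ : n < j.+1)%N) ?jn // mulr0 addr0 qfact0
    mulr1 qfactS.
  by have := IHn 0%N n erefl; rewrite qfact0 mulr1 mulrA => ->.
- by rewrite qbin0 qfact0 !mul1r -mjn addn0.
have /IHn IHj : (m.+1 + j = n)%N by lia.
have /IHn IHm : (m + j.+1 = n)%N by lia.
have -> : qfact n.+1 =
    (1 - y ^+ j.+1) * qfact n + y ^+ j.+1 * ((1 - y ^+ m.+1) * qfact n).
  by rewrite qfactS -mjn addnC exprD; ring.
rewrite -{1}IHj -IHm qbinS !qfactS; ring.
Qed.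

Lemma q_binomial n s t :
  \prod_(k < n) (s + t * y ^+ k) =
  \sum_(j < n.+1) y ^+ 'C(j, 2) * qbin n j * t ^+ j * s ^+ (n - j).
Proof.
elim: n t => [|n IHn] t; first by rewrite big_ord0 big_ord1 qbin0 !expr0 !mulr1.
rewrite big_ord_recl expr0 mulr1.
under eq_bigr do rewrite /= /bump /= add1n exprS mulrA.
rewrite IHn mulrDl.
have -> : s * (\sum_(j < n.+1)
      y ^+ 'C(j, 2) * qbin n j * (t * y) ^+ j * s ^+ (n - j)) =
    \sum_(j < n.+2) y ^+ ('C(j, 2) + j) * qbin n j * t ^+ j * s ^+ (n.+1 - j).
  rewrite [RHS]big_ord_recr /= qbin_small // mulr0 !mul0r addr0 mulr_sumr.
  apply: eq_bigr => j _; rewrite subSn -1?ltnS // exprMn exprS exprD; ring.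
rewrite [X in X + _]big_ord_recl [RHS]big_ord_recl /= !expr0 !qbin0
  subn0 -addrA.
congr (_ + _); rewrite mulr_sumr -big_split /=; apply: eq_bigr => j _.
rewrite /bump /= !add1n qbinS subSS binS bin1 exprMn !exprD exprS.
by rewrite [t ^+ _.+1]exprS; ring.
Qed.

End GaussianBinomial.

Lemma bin2_double n : (2 * 'C(n, 2) + n = n * n)%N.
Proof. by elim: n => // n IHn; rewrite binS bin1; lia. Qed.

Section JacobiTripleProduct.
Variable K : comNzRingType.
Implicit Types (a d M j : nat) (i : int).
Local Notation X := (fpsX K).

Definition theta_form a d i : int := (a + d)%:Z * (i * (i - 1)) + 2 * a%:Z * i.

Definition theta_exp a d i : nat := (`|theta_form a d i| %/ 2)%N.

Lemma theta_expE a d i : 2 * (theta_exp a d i)%:Z = theta_form a d i.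
Proof.
have [k ik] : exists k, i * (i - 1) = 2 * k.
  have [k [->|->]] : exists k, i = 2 * k \/ i = 2 * k + 1.
    by exists (i %/ 2)%Z; lia.
    by exists (k * (2 * k - 1)); ring.
  by exists (k * (2 * k + 1)); ring.
have: (0 <= k /\ 0 <= k + i) by nia.
rewrite /theta_exp /theta_form ik; nia.
Qed.

Lemma absz_le_theta_exp a d i : (0 < a)%N -> (0 < d)%N ->
  (`|i| <= theta_exp a d i)%N.
Proof. by move=> a0 d0; have := theta_expE a d i; rewrite /theta_form; nia. Qed.

Definition theta a d : fps K :=
  genser (fun i : int => (-1) ^+ `|i|%N) (theta_exp a d).

Definition int_range M : seq int :=
  [seq j%:Z - M%:Z | j <- index_iota 0 (2 * M).+1].

Lemma mem_int_range M i : (i \in int_range M) = (`|i| <= M)%N.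
Proof.
apply/mapP/idP => [[j]|iM]; first by rewrite mem_index_iota => jM ->; lia.
by exists (absz (i + M%:Z)); rewrite ?mem_index_iota; lia.
Qed.

Lemma int_range_uniq M : uniq (int_range M).
Proof. by rewrite map_inj_uniq ?iota_uniq // => i j; lia. Qed.

Lemma covers_theta_exp a d N : (0 < a)%N -> (0 < d)%N ->
  covers (theta_exp a d) N.+1 (int_range N).
Proof.
move=> a0 d0; split=> [|i]; first exact: int_range_uniq.
by rewrite mem_int_range; have := absz_le_theta_exp i a0 d0; lia.
Qed.

Lemma theta_exp_locally_finite a d : (0 < a)%N -> (0 < d)%N ->
  locally_finite (theta_exp a d).
Proof.
move=> a0 d0 N; exists (int_range N.-1).
by case: N => [|N]; [split=> //; apply: int_range_uniq|apply: covers_theta_exp].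
Qed.

Lemma theta_exp_shift a d M j : (j <= 2 * M)%N ->
  ((a + d) * 'C(j, 2) + a * j + (a + d) * M * (2 * M - j) =
   (a * M + (a + d) * 'C(M, 2) + (a + d) * M * M) +
     theta_exp a d (j%:Z - M%:Z))%N.
Proof.
move=> jM; have := theta_expE a d (j%:Z - M%:Z); rewrite /theta_form.
have := congr1 (muln (a + d)) (bin2_double j).
have := congr1 (muln (a + d)) (bin2_double M).
move: 'C(j, 2) 'C(M, 2) (theta_exp _ _ _) jM => cj cM t jM.
nia.
Qed.

Lemma prod_theta_factors a d M :
  \prod_(k < M + M) (X ^+ ((a + d) * M) + - X ^+ a * X ^+ (a + d) ^+ k) =
  (-1) ^+ M * X ^+ (a * M + (a + d) * 'C(M, 2) + (a + d) * M * M) *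
  \prod_(k < M) ((1 - X ^+ (a + (a + d) * k)) * (1 - X ^+ (d + (a + d) * k))).
Proof.
set b := (a + d)%N; rewrite big_split_ord /=.
under eq_bigr => k _.
  have -> : X ^+ (b * M) + - X ^+ a * X ^+ b ^+ k =
      - X ^+ (a + b * k) * (1 - X ^+ (d + b * (M - k.+1))).
    rewrite mulrBr mulr1 !mulNr opprK -exprM -!exprD addrC.
    by congr (_ + X ^+ _); have := ltn_ord k; rewrite /b; nia.
  over.
under [X in _ * X = _]eq_bigr => k _.
  have -> : X ^+ (b * M) + - X ^+ a * X ^+ b ^+ (M + k) =
      X ^+ (b * M) * (1 - X ^+ (a + b * k)).
    rewrite mulrBr mulr1 mulNr -exprM -!exprD.
    by congr (_ - X ^+ _); nia.
  over.
rewrite !big_split /= prodrN card_ord -expr_sum.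
rewrite prodr_const card_ord -exprM.
rewrite [X in _ * X * _ = _](reindex_inj rev_ord_inj) /=.
under [X in _ * X * _ = _]eq_bigr => k _ do rewrite subnSK // subKn 1?ltnW //.
have -> : (\sum_(k < M) (a + b * k) = a * M + b * 'C(M, 2))%N.
  by rewrite big_split sum_nat_const card_ord -big_distrr -bin2_sum
    big_mkord mulnC.
rewrite !exprD; ring.
Qed.

Lemma finite_jacobi a d M :
  \prod_(k < M) ((1 - X ^+ (a + (a + d) * k)) * (1 - X ^+ (d + (a + d) * k))) =
  \sum_(j < (2 * M).+1) (-1) ^+ `|j%:Z - M%:Z|%N *
    X ^+ theta_exp a d (j%:Z - M%:Z) * qbin (X ^+ (a + d)) (2 * M) j.
Proof.
set c := (a * M + (a + d) * 'C(M, 2) + (a + d) * M * M)%N.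
apply: (@fpsXnI _ c); rewrite -[LHS](signrMK M) [_ * (X ^+ c * _)]mulrA.
rewrite -prod_theta_factors q_binomial !mulr_sumr addnn -mul2n.
apply: eq_bigr => -[j /= /ltnSE jM] _.
have exponents : X ^+ (a + d) ^+ 'C(j, 2) * X ^+ a ^+ j *
      X ^+ ((a + d) * M) ^+ (2 * M - j) =
    X ^+ c * X ^+ theta_exp a d (j%:Z - M%:Z).
  by rewrite -!exprM -!exprD theta_exp_shift.
have -> : (-1) ^+ `|j%:Z - M%:Z|%N = (-1) ^+ M * (-1) ^+ j :> fps K.
  rewrite -exprD -signr_odd -[RHS]signr_odd; congr (_ ^+ nat_of_bool _); lia.
rewrite [RHS](_ : _ = (-1) ^+ M * (-1) ^+ j *
  (X ^+ c * X ^+ theta_exp a d (j%:Z - M%:Z)) *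
  qbin (X ^+ (a + d)) (2 * M) j); last by ring.
by rewrite -exponents [(- X ^+ a) ^+ j]exprNn; ring.
Qed.

Lemma eqmodX_qfact b n : (0 < b)%N ->
  eqmodX n.+1 (qfact (X ^+ b) n) (poch K b b).
Proof.
move=> b0; apply/eqmodX_sym; apply: eqmodX_trans (eqmodX_poch _ b0 b0) _.
by apply: eqmodX_prod => k _; rewrite -exprM mulnS.
Qed.

Lemma eqmodX_qbin_poch b m j : (0 < b)%N ->
  eqmodX (minn m j).+1 (qbin (X ^+ b) (m + j) j * poch K b b) 1.
Proof.
move=> b0; set N := (minn m j).+1.
have pochE n : (N <= n.+1)%N -> eqmodX N (poch K b b) (qfact (X ^+ b) n).
  by move=> Nn; apply/eqmodX_sym/(eqmodX_leq Nn)/eqmodX_qfact.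
have : eqmodX N (qbin (X ^+ b) (m + j) j * poch K b b * poch K b b)
    (poch K b b).
  apply: (@eqmodX_trans _ _ _ (qfact (X ^+ b) (m + j))).
    by rewrite -qbin_qfact; apply: eqmodXM; [apply: eqmodXM => //|];
      apply: pochE; lia.
  by apply/eqmodX_sym/pochE; lia.
move/(@eqmodXM _ _ _ (pochV K b b))/(_ (@eqmodX_refl _ _ _)).
by rewrite -!mulrA poch_pochV // mulr1.
Qed.

Lemma jacobi_triple a d : (0 < a)%N -> (0 < d)%N ->
  poch K a (a + d) * poch K d (a + d) * poch K (a + d) (a + d) = theta a d.
Proof.
move=> a0 d0; have b0 : (0 < a + d)%N by lia.
apply: eqmodX_eq => N.
apply: (@eqmodX_trans _ _ _ ((\prod_(k < N) ((1 - X ^+ (a + (a + d) * k)) *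
   (1 - X ^+ (d + (a + d) * k)))) * poch K (a + d) (a + d))).
  by rewrite big_split /=; do 2!apply: eqmodXM => //; apply: eqmodX_poch.
apply/eqmodX_sym.
apply: eqmodX_trans (eqmodX_genser _ (covers_theta_exp _ a0 d0)) _.
apply/eqmodX_sym; rewrite finite_jacobi mulr_suml big_map big_mkord.
apply: eqmodX_sum => -[j /= /ltnSE jN] _.
rewrite rmorph_sign -2!mulrA -[X in eqmodX _ _ (_ * X)]mulr1.
apply/eqmodXM => //; apply: eqmodXXnM.
have -> : qbin (X ^+ (a + d)) (2 * N) j = qbin (X ^+ (a + d)) (2 * N - j + j) j.
  by rewrite subnK.
apply: (eqmodX_leq _ (@eqmodX_qbin_poch _ (2 * N - j) j b0)).
by have := absz_le_theta_exp (j%:Z - N%:Z) a0 d0; lia.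
Qed.

End JacobiTripleProduct.

(** * The 5-dissection of the product of two quintic theta series *)

Section ThetaDissection.
Variable K : numDomainType.
Implicit Types (a d c m : nat) (x y : int * int).
Local Notation X := (fpsX K).

Definition parity2 x := odd (`|x.1| + `|x.2|).

Definition sign2 x : K := (-1) ^+ `|x.1|%N * (-1) ^+ `|x.2|%N.

Lemma sign2_addb x y (b : bool) :
  parity2 y = b (+) parity2 x -> sign2 y = (-1) ^+ b * sign2 x.
Proof.
rewrite /parity2 /sign2 => parity.
rewrite -(exprD _ `|y.1|) -(exprD _ `|x.1|) -signr_odd.
by rewrite parity signr_addb signr_odd.
Qed.

Definition theta_exp2 a d a' d' x :=
  (theta_exp a d x.1 + theta_exp a' d' x.2)%N.

Definition theta_form2 a d a' d' x := theta_form a d x.1 + theta_form a' d' x.2.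

Lemma theta_exp2E a d a' d' x :
  2 * (theta_exp2 a d a' d' x)%:Z = theta_form2 a d a' d' x.
Proof. by rewrite PoszD mulrDr !theta_expE. Qed.

Lemma thetaM a d a' d' : [/\ 0 < a, 0 < d, 0 < a' & 0 < d']%N ->
  theta K a d * theta K a' d' = genser sign2 (theta_exp2 a d a' d').
Proof. by case=> *; apply: genserM; apply: theta_exp_locally_finite. Qed.

Lemma compXn_thetaM m c a d a' d' : [/\ 0 < a, 0 < d, 0 < a' & 0 < d']%N ->
  (0 < m)%N ->
  X ^+ c * compXn m (theta K a d * theta K a' d') =
  genser sign2 (fun x => c + m * theta_exp2 a d a' d' x)%N.
Proof. by move=> pos m0; rewrite thetaM // compXn_genser // genserXn. Qed.

(* Multiplication by the Gaussian integer 1 + 2i, conjugated, translated to each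
   of the five cosets of its image. *)
Definition gauss5 (r : 'I_5) x := (x.1 + 2 * x.2, 2 * x.1 - x.2 + r%:Z).

Lemma gauss5_bij : bijective (fun z : 'I_5 * (int * int) => gauss5 z.1 z.2).
Proof.
pose residue y : 'I_5 := inord `|((y.2 - 2 * y.1) %% 5)%Z|.
have residueE y : (residue y)%:Z = ((y.2 - 2 * y.1) %% 5)%Z.
  by rewrite /residue inordK; lia.
pose quot y := ((2 * y.1 - y.2 + (residue y)%:Z) %/ 5)%Z.
exists (fun y => (residue y, (y.1 - 2 * quot y, quot y))).
  move=> [r [u s]]; have rE : residue (gauss5 r (u, s)) = r.
    by apply/val_inj/eqP; rewrite -eqz_nat residueE /=; have := ltn_ord r; lia.
  by rewrite /quot rE /=; congr (_, (_, _)); lia.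
move=> [u s]; have := residueE (u, s); rewrite /gauss5 /quot /=.
by move: (residue _) => r rE; congr (_, _); lia.
Qed.

Local Notation coset r :=
  (genser (sign2 \o gauss5 r) (theta_exp2 1 4 2 3 \o gauss5 r)).

Lemma coset_theta (r : 'I_5) h (b : bool) c a d a' d' :
  bijective h -> [/\ 0 < a, 0 < d, 0 < a' & 0 < d']%N ->
  (forall x, parity2 (gauss5 r (h x)) = b (+) parity2 x) ->
  (forall x, theta_form2 1 4 2 3 (gauss5 r (h x)) =
             2 * c%:Z + 5 * theta_form2 a d a' d' x) ->
  coset r = (-1) ^+ b * (X ^+ c * compXn 5 (theta K a d * theta K a' d')).
Proof.
move=> h_bij pos parity forms.
rewrite (genser_reindex _ _ h_bij) compXn_thetaM //
  -(rmorph_sign (@fps_const K)).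
rewrite -genserZ; apply: eq_genser => x; first exact/sign2_addb/parity.
by have := forms x; rewrite -!theta_exp2E /=; lia.
Qed.

Lemma coset_cancel (r : 'I_5) h : involutive h ->
  (forall x, parity2 (gauss5 r (h x)) = ~~ parity2 (gauss5 r x)) ->
  (forall x, theta_form2 1 4 2 3 (gauss5 r (h x)) =
             theta_form2 1 4 2 3 (gauss5 r x)) ->
  coset r = 0.
Proof.
move=> hK parity forms; apply: (genser_antisym hK) => x.
  by rewrite /= (@sign2_addb (gauss5 r x) _ true) ?parity // expr1 mulN1r.
by have := forms x; rewrite -!theta_exp2E /=; lia.
Qed.

Lemma coset0_theta23 : coset (inord 0) = compXn 5 (theta K 2 3 * theta K 2 3).
Proof.
rewrite (@coset_theta _ id false 0 2 3 2 3) ?mul1r //; first by exists id.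
  by move=> [u s]; rewrite /parity2 /= inordK; lia.
by move=> [u s]; rewrite /theta_form2 /theta_form /= inordK //; ring.
Qed.

Lemma coset1_theta14 : coset (inord 1) =
  - (X ^+ 2 * compXn 5 (theta K 1 4 * theta K 1 4)).
Proof.
rewrite (@coset_theta _ (fun x => (- x.1, x.2)) true 2 1 4 1 4) ?mulN1r //.
- by apply: inv_bij => -[u s]; rewrite /= opprK.
- by move=> [u s]; rewrite /parity2 /= inordK; lia.
by move=> [u s]; rewrite /theta_form2 /theta_form /= inordK //; ring.
Qed.

Lemma coset2_eq0 : coset (inord 2) = 0.
Proof.
apply: (@coset_cancel _ (fun x => (x.1, 1 - x.2))).
- by move=> [u s]; congr (_, _) => /=; lia.
- by move=> [u s]; rewrite /parity2 /= inordK; lia.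
by move=> [u s]; rewrite /theta_form2 /theta_form /= inordK //; ring.
Qed.

Lemma coset3_theta14_theta23 : coset (inord 3) =
  - (X * compXn 5 (theta K 1 4 * theta K 2 3)).
Proof.
rewrite (@coset_theta _ (fun x => (-1 - x.2, 1 - x.1)) true 1 1 4 2 3)
  ?mulN1r //.
- exists (fun x => (1 - x.2, -1 - x.1)) => -[u s]; congr (_, _) => /=; lia.
- by move=> [u s]; rewrite /parity2 /= inordK; lia.
by move=> [u s]; rewrite /theta_form2 /theta_form /= inordK //; ring.
Qed.

Lemma coset4_eq0 : coset (inord 4) = 0.
Proof.
apply: (@coset_cancel _ (fun x => (-3 - x.1, x.2))).
- by move=> [u s]; congr (_, _) => /=; lia.
- by move=> [u s]; rewrite /parity2 /= inordK; lia.
by move=> [u s]; rewrite /theta_form2 /theta_form /= inordK //; ring.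
Qed.

Lemma theta_dissection :
  theta K 1 4 * theta K 2 3 =
  compXn 5 (theta K 2 3 * theta K 2 3)
  - X * compXn 5 (theta K 1 4 * theta K 2 3)
  - X ^+ 2 * compXn 5 (theta K 1 4 * theta K 1 4).
Proof.
rewrite [LHS]thetaM // (genser_cosets _ gauss5_bij); last first.
  by apply: locally_finiteD; apply: theta_exp_locally_finite.
rewrite (eq_bigr (fun r : 'I_5 => coset (inord r))); last first.
  by move=> r _; rewrite inord_val.
rewrite !big_ord_recr big_ord0 /= coset0_theta23 coset1_theta14 coset2_eq0.
rewrite coset3_theta14_theta23 coset4_eq0; ring.
Qed.

End ThetaDissection.

(** * The norm over the dilations by roots of unity *)

Lemma prime_primitive_root (K : closedFieldType) p :
  prime p -> p%:R != 0 :> K -> exists z : K, p.-primitive_root z.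
Proof.
move=> p_pr p_neq0; pose P : {poly K} := \poly_(i < p) 1.
have /closed_rootP[z Pz0] : size P != 1%N.
  by rewrite size_poly_eq ?oner_eq0 // neq_ltn prime_gt1 ?orbT.
have {Pz0} sum0 : \sum_(i < p) z ^+ i = 0.
  by move/eqP: Pz0; rewrite horner_poly; under eq_bigr do rewrite mul1r.
have zp : z ^+ p = 1 by apply/subr0_eq; rewrite subrX1 sum0 mulr0.
have [d prim_z] := prim_order_exists (prime_gt0 p_pr) zp.
case/primeP: p_pr => _ dvdp /dvdp/predU1P[d1|/eqP dp]; last first.
  by exists z; rewrite -dp.
have z1 : z = 1 by rewrite -(prim_expr_order prim_z) d1.
case/eqP: p_neq0; rewrite -sum0 z1; under eq_bigr do rewrite expr1n.
by rewrite sumr_const card_ord.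
Qed.

Lemma sum_prim_root (K : idomainType) m (z : K) :
  m.-primitive_root z -> (1 < m)%N -> \sum_(i < m) z ^+ i = 0.
Proof.
move=> prim_z m1; have z1 : z - 1 != 0.
  by rewrite subr_eq0 -(expr1 z) -(prim_order_dvd prim_z) gtnNdvd.
by apply: (mulfI z1); rewrite -subrX1 (prim_expr_order prim_z) subrr mulr0.
Qed.

Section DilationNorm.
Variables (K : fieldType) (m : nat) (z : K).
Hypothesis prim_z : m.-primitive_root z.
Implicit Types f g : fps K.

Lemma prod_1BZX_prim_root :
  \prod_(i < m) (1 - z ^+ i *: 'X) = 1 - 'X^m :> {poly K}.
Proof.
have m0 := prim_order_gt0 prim_z.
have z_unit : z \is a GRing.unit.
  by rewrite -(unitrX_pos z m0) (prim_expr_order prim_z) unitr1.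
have prim_zV : m.-primitive_root z^-1.
  have -> : z^-1 = z ^+ m.-1.
    by rewrite -[LHS]mul1r -(prim_expr_order prim_z) -{1}(prednK m0)
      exprSr mulrK.
  by rewrite prim_root_exp_coprime // -{2}(prednK m0) coprimenS.
have prod_XsubC : \prod_(i < m) ('X - (z^-1 ^+ i)%:P) = 'X^m - 1 :> {poly K}.
  by rewrite -(factor_Xn_sub_1 prim_zV) big_mkord.
have factorE i : 1 - z ^+ i *: 'X =
    (- z ^+ i) *: ('X - (z^-1 ^+ i)%:P) :> {poly K}.
  rewrite scalerBr !scaleNr opprK addrC -[_ *: _%:P]mul_polyC -polyCM exprVn.
  by rewrite divrr ?unitrX.
have prod_oppV : \prod_(i < m) (- (z^-1 ^+ i)) = -1 :> K.
  have := congr1 (fun p => p.[0]) prod_XsubC.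
  rewrite horner_prod !hornerE expr0n gtn_eqF // sub0r => <-.
  by apply: eq_bigr => i _; rewrite !hornerE.
have prod_opp : \prod_(i < m) (- z ^+ i) = -1 :> K.
  have : (\prod_(i < m) - z ^+ i) * \prod_(i < m) (- (z^-1 ^+ i)) = 1.
    by rewrite -big_split /= big1 // => i _;
      rewrite mulrNN -exprMn divrr // expr1n.
  by rewrite prod_oppV mulrN1 => /eqP; rewrite eqr_oppLR => /eqP.
under eq_bigr do rewrite factorE.
by rewrite scaler_prod prod_XsubC prod_opp scaleN1r opprB.
Qed.

Lemma prod_1B_prim_root f :
  \prod_(i < m) (1 - fps_const (z ^+ i) * f) = 1 - f ^+ m.
Proof.
have := congr1 (fun p => (map_poly (@fps_const K) p).[f]) prod_1BZX_prim_root.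
rewrite /= rmorphB rmorph1 /= map_polyXn !hornerE => <-.
rewrite rmorph_prod horner_prod; apply: eq_bigr => i _.
by rewrite rmorphB rmorph1 /= map_polyZ map_polyX !hornerE.
Qed.

Definition dilate_norm f := \prod_(i < m) dilate (z ^+ i) f.

Lemma dilate_normM f g : dilate_norm (f * g) = dilate_norm f * dilate_norm g.
Proof. by rewrite -big_split; apply: eq_bigr => i _; apply: rmorphM. Qed.

Lemma dilate_norm1 : dilate_norm 1 = 1.
Proof. by apply: big1 => i _; apply: rmorph1. Qed.

Lemma dilate_norm_compXn f : dilate_norm (compXn m f) = compXn m f ^+ m.
Proof.
rewrite /dilate_norm; under eq_bigr => i _.
  rewrite dilate_compXn; first over.
  by rewrite exprAC (prim_expr_order prim_z) expr1n.
by rewrite prodr_const card_ord.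
Qed.

Lemma eqmodX_dilate_norm N f g :
  eqmodX N f g -> eqmodX N (dilate_norm f) (dilate_norm g).
Proof. by move=> fg; apply: eqmodX_prod => i _; apply: eqmodX_dilate. Qed.

End DilationNorm.

Lemma dilate_norm_1BXn (K : fieldType) m (z : K) r : m.-primitive_root z ->
  coprime r m -> dilate_norm m z (1 - fpsX K ^+ r) = compXn m (1 - fpsX K ^+ r).
Proof.
move=> prim_z co_rm.
have prim_zr : m.-primitive_root (z ^+ r) by rewrite prim_root_exp_coprime.
rewrite rmorphB rmorph1 rmorphXn /= (compXnX _ (prim_order_gt0 prim_z)) exprAC.
rewrite -(prod_1B_prim_root prim_zr); apply: eq_bigr => i _.
by rewrite rmorphB rmorph1 rmorphXn /= dilateX exprMn -rmorphXn exprAC.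
Qed.

Lemma dilate_norm_poch (K : fieldType) m (z : K) r : m.-primitive_root z ->
  (0 < r)%N -> coprime r m ->
  dilate_norm m z (poch K r m) = compXn m (poch K r m).
Proof.
move=> prim_z r0 co_rm; have m0 := prim_order_gt0 prim_z.
apply: eqmodX_eq => N; have pochE := @eqmodX_poch K r m N r0 m0.
apply: eqmodX_trans (eqmodX_dilate_norm m z pochE) _.
apply: (eqmodX_trans _ (eqmodX_sym (eqmodX_compXn m pochE))).
rewrite rmorph_prod (big_morph _ (dilate_normM m z) (dilate_norm1 m z)).
apply: eqmodX_prod => k _; rewrite dilate_norm_1BXn //.
by rewrite /coprime addnC mulnC gcdnC gcdnMDl gcdnC.
Qed.

Lemma norm_fifth_roots (A : comNzRingType) (z a b c : A) :
  1 + z + z ^+ 2 + z ^+ 3 + z ^+ 4 = 0 ->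
  \prod_(i < 5) (a - z ^+ i * b - (z ^+ i) ^+ 2 * c) =
  a ^+ 5 - b ^+ 5 - c ^+ 5 - 5 * (a * b ^+ 3 * c) - 5 * (a ^+ 2 * b * c ^+ 2).
Proof.
move=> sum0; have z4 : z ^+ 4 = - 1 - z - z ^+ 2 - z ^+ 3.
  by apply/eqP; rewrite -subr_eq0 -sum0; apply/eqP; ring.
rewrite !big_ord_recr big_ord0 /=; ring: z4.
Qed.

(** * The quintic relation between f(q) and f(q^5) *)

Section QuinticModularPolynomials.
Variable A : comNzRingType.
Implicit Types v : A.

Definition quinticP v := 1 - v - v ^+ 2.
Definition quinticN v := 1 - 2 * v + 4 * v ^+ 2 - 3 * v ^+ 3 + v ^+ 4.
Definition quinticM v := 1 + 3 * v + 4 * v ^+ 2 + 2 * v ^+ 3 + v ^+ 4.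

Lemma quinticPNM v :
  quinticP v * quinticN v * quinticM v = 1 - 11 * v ^+ 5 - v ^+ 10.
Proof. rewrite /quinticP /quinticN /quinticM; ring. Qed.

Lemma quinticP_exp5 v : quinticP v ^+ 5 =
  quinticM v ^+ 2 - 11 * v * quinticM v * quinticN v - v ^+ 2 * quinticN v ^+ 2.
Proof. rewrite /quinticP /quinticN /quinticM; ring. Qed.

Definition PN2_coefs : seq int :=
  [:: 1; -5; 15; -30; 40; -36; 15; 5; -10; 5; -1].
Definition PM2_coefs : seq int :=
  [:: 1; 5; 10; 5; -15; -36; -40; -30; -15; -5; -1].

Lemma quinticPN2 v :
  quinticP v * quinticN v ^+ 2 = \sum_(k < 11) v ^+ k *~ PN2_coefs`_k.
Proof.
rewrite !big_ord_recr big_ord0 /= /quinticP /quinticN; ring.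
Qed.

Lemma quinticPM2 v :
  quinticP v * quinticM v ^+ 2 = \sum_(k < 11) v ^+ k *~ PM2_coefs`_k.
Proof.
rewrite !big_ord_recr big_ord0 /= /quinticP /quinticM; ring.
Qed.

End QuinticModularPolynomials.

Section RogersRamanujanProducts.
Variable K : comNzRingType.
Local Notation "'P_' a" := (poch K a 5) (at level 2, a at level 1).
Local Notation "'V_' a" := (pochV K a 5) (at level 2, a at level 1).

(* The series f, g = 1/f and e = E_5/E_1 of the header. *)
Definition rrfrac := P_ 1 * P_ 4 * (V_ 2 * V_ 3).
Definition rrfracV := P_ 2 * P_ 3 * (V_ 1 * V_ 4).
Definition regular5 := V_ 1 * V_ 2 * V_ 3 * V_ 4.

Lemma poch5_pochV a : (0 < a)%N -> P_ a * V_ a = 1.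
Proof. by move=> a0; apply: poch_pochV. Qed.

Lemma rrfracVK : rrfracV * rrfrac = 1.
Proof.
rewrite /rrfrac /rrfracV.
ring: (@poch5_pochV 1 isT) (@poch5_pochV 2 isT) (@poch5_pochV 3 isT)
  (@poch5_pochV 4 isT).
Qed.

Lemma fcoef_rrfrac0 : fcoef rrfrac 0 = 1.
Proof. by rewrite !fcoef0M !fcoef_poch0 !fcoef_pochV0 !mulr1. Qed.

Lemma fcoef_rrfracV0 : fcoef rrfracV 0 = 1.
Proof. by rewrite !fcoef0M !fcoef_poch0 !fcoef_pochV0 !mulr1. Qed.

Lemma fcoef_poch_exp5M0 a b : fcoef (P_ a ^+ 5 * P_ b ^+ 5) 0 = 1.
Proof. by rewrite fcoef0M !fcoef0X !fcoef_poch0 expr1n mulr1. Qed.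

Lemma pochM_rrfrac : P_ 2 * P_ 3 * rrfrac = P_ 1 * P_ 4.
Proof. by rewrite /rrfrac; ring: (@poch5_pochV 2 isT) (@poch5_pochV 3 isT). Qed.

Lemma pochM_rrfracV : P_ 1 * P_ 4 * rrfracV = P_ 2 * P_ 3.
Proof.
by rewrite /rrfracV; ring: (@poch5_pochV 1 isT) (@poch5_pochV 4 isT).
Qed.

Lemma poch_exp5M_rrfrac :
  P_ 2 ^+ 5 * P_ 3 ^+ 5 * rrfrac ^+ 5 = P_ 1 ^+ 5 * P_ 4 ^+ 5.
Proof. by rewrite -!exprMn pochM_rrfrac. Qed.

Lemma poch_exp5M_rrfracV :
  P_ 1 ^+ 5 * P_ 4 ^+ 5 * rrfracV ^+ 5 = P_ 2 ^+ 5 * P_ 3 ^+ 5.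
Proof. by rewrite -!exprMn pochM_rrfracV. Qed.

Lemma poch_exp5M_compXn5_rrfrac :
  compXn 5 (P_ 2 * P_ 3) * (P_ 1 ^+ 5 * P_ 4 ^+ 5) *
  (compXn 5 rrfrac * rrfracV ^+ 5) =
  compXn 5 (P_ 1 * P_ 4) * (P_ 2 ^+ 5 * P_ 3 ^+ 5).
Proof. by rewrite mulrACA -compXnM pochM_rrfrac poch_exp5M_rrfracV. Qed.

Lemma rrfrac_regular5 : rrfrac * regular5 = (V_ 2 * V_ 3) ^+ 2.
Proof.
rewrite /rrfrac /regular5; ring: (@poch5_pochV 1 isT) (@poch5_pochV 4 isT).
Qed.

Lemma rrfracV_regular5 : rrfracV * regular5 = (V_ 1 * V_ 4) ^+ 2.
Proof.
rewrite /rrfracV /regular5; ring: (@poch5_pochV 2 isT) (@poch5_pochV 3 isT).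
Qed.

Lemma poch11_split5 : poch K 1 1 = P_ 1 * P_ 2 * P_ 3 * P_ 4 * P_ 5.
Proof. by rewrite (@poch_split K 5) // !big_ord_recr big_ord0 /= mul1r. Qed.

Lemma poch11_regular5 : poch K 1 1 * regular5 = P_ 5.
Proof.
rewrite poch11_split5 /regular5.
ring: (@poch5_pochV 1 isT) (@poch5_pochV 2 isT) (@poch5_pochV 3 isT)
  (@poch5_pochV 4 isT).
Qed.

Lemma compXn5_poch11 : compXn 5 (poch K 1 1) = P_ 5.
Proof. exact: compXn_poch. Qed.

End RogersRamanujanProducts.

Section QuinticRelation.
Variable K : numClosedFieldType.
Local Notation X := (fpsX K).
Local Notation "'P_' a" := (poch K a 5) (at level 2, a at level 1).
Local Notation f := (rrfrac K).
Local Notation g := (rrfracV K).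
Local Notation e := (regular5 K).
Local Notation F := (compXn 5 f).
Local Notation G := (compXn 5 g).
Local Notation E25 := (compXn 5 (poch K 5 5)).

Lemma compXn5_rrfracVK : G * F = 1.
Proof. by rewrite -rmorphM rrfracVK rmorph1. Qed.

Lemma poch11_dissection : poch K 1 1 = E25 * (G - X - X ^+ 2 * F).
Proof.
apply: (@fps_mulfI _ (P_ 5)); first by rewrite fcoef_poch0 oner_eq0.
have theta14 : theta K 1 4 = P_ 1 * P_ 4 * P_ 5 by rewrite -jacobi_triple.
have theta23 : theta K 2 3 = P_ 2 * P_ 3 * P_ 5 by rewrite -jacobi_triple.
have thetaE : theta K 1 4 * theta K 2 3 = poch K 1 1 * P_ 5.
  rewrite theta14 theta23 poch11_split5; ring.
have theta23_sqr : theta K 2 3 * theta K 2 3 = g * (poch K 1 1 * P_ 5).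
  rewrite -thetaE theta14 theta23 /rrfracV.
  ring: (@poch5_pochV K 1 isT) (@poch5_pochV K 4 isT).
have theta14_sqr : theta K 1 4 * theta K 1 4 = f * (poch K 1 1 * P_ 5).
  rewrite -thetaE theta14 theta23 /rrfrac.
  ring: (@poch5_pochV K 2 isT) (@poch5_pochV K 3 isT).
have := theta_dissection K; rewrite theta14_sqr theta23_sqr thetaE.
rewrite !(compXnM _ _ (poch K 1 1 * _)) (compXnM _ (poch K 1 1)) compXn5_poch11.
rewrite mulrC => ->; ring.
Qed.

Lemma poch55_exp6 :
  P_ 5 ^+ 6 = E25 ^+ 6 * (G ^+ 5 - 11 * X ^+ 5 - X ^+ 10 * F ^+ 5).
Proof.
have [z prim_z] : exists z : K, 5.-primitive_root z.
  by apply: prime_primitive_root; rewrite ?pnatr_eq0.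
have <- : dilate_norm 5 z (poch K 1 1) * E25 = P_ 5 ^+ 6.
  have norm5 : dilate_norm 5 z (P_ 5) = P_ 5 ^+ 5.
    by rewrite -compXn5_poch11 (dilate_norm_compXn prim_z).
  rewrite {1}poch11_split5 !dilate_normM norm5 !(dilate_norm_poch prim_z) //.
  rewrite mulrAC -!rmorphM /= -poch11_split5 compXn5_poch11 -exprS //.
set Z := fps_const z.
have sumZ : 1 + Z + Z ^+ 2 + Z ^+ 3 + Z ^+ 4 = 0.
  rewrite -[RHS](rmorph0 (@fps_const K)) -(sum_prim_root prim_z) //.
  by rewrite !big_ord_recr big_ord0 !rmorphD !rmorphXn /= rmorph0 add0r.
have z5 i : (z ^+ i) ^+ 5 = 1 by rewrite exprAC (prim_expr_order prim_z) expr1n.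
have normE : dilate_norm 5 z (G - X - X ^+ 2 * F) =
    G ^+ 5 - 11 * X ^+ 5 - X ^+ 10 * F ^+ 5.
  transitivity (\prod_(i < 5) (G - Z ^+ i * X - (Z ^+ i) ^+ 2 * (X ^+ 2 * F))).
    apply: eq_bigr => i _.
    rewrite !dilateB dilateM (rmorphXn (dilate _)) /= dilateX.
    by rewrite !(dilate_compXn _ (z5 i)) exprMn
      (rmorphXn (@fps_const K)) /= mulrA.
  rewrite norm_fifth_roots //; ring: compXn5_rrfracVK.
rewrite {1}poch11_dissection dilate_normM (dilate_norm_compXn prim_z)
  normE; ring.
Qed.

Definition rrdisc := g ^+ 5 - 11 * X - X ^+ 2 * f ^+ 5.

Lemma poch11_exp6 : poch K 1 1 ^+ 6 = P_ 5 ^+ 6 * rrdisc.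
Proof.
apply: (@compXnI _ 5) => //.
have -> : compXn 5 (poch K 1 1 ^+ 6) = P_ 5 ^+ 6.
  by rewrite -compXn5_poch11 rmorphXn.
rewrite compXnM (rmorphXn (compXn 5)) poch55_exp6 /rrdisc !compXnB.
rewrite (compXnM _ 11) (compXnM _ (X ^+ 2)).
by rewrite !(rmorphXn (compXn 5)) (rmorph_nat (compXn 5)) /= compXnX // -exprM.
Qed.

Lemma regular5_exp6 : e ^+ 6 * rrdisc = 1.
Proof.
apply: (@fps_mulfI _ (P_ 5 ^+ 6)).
  by rewrite fcoef0X fcoef_poch0 expr1n oner_eq0.
by rewrite mulrCA -poch11_exp6 mulr1 -exprMn mulrC poch11_regular5.
Qed.

Local Notation v := (X * F).

Lemma fcoef_quinticP0 : fcoef (quinticP v) 0 = 1.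
Proof.
have -> : quinticP v = 1 + X * (F * (- 1 - v)) by rewrite /quinticP; ring.
by rewrite fcoefD fcoef0M mul0r fcoef1 addr0.
Qed.

Lemma fcoef_quinticM0 : fcoef (quinticM v) 0 = 1.
Proof.
have -> : quinticM v = 1 + X * (F * (3 + 4 * v + 2 * v ^+ 2 + v ^+ 3)).
  by rewrite /quinticM; ring.
by rewrite fcoefD fcoef0M mul0r fcoef1 addr0.
Qed.

Lemma quinticP_rrdisc :
  G * quinticP v ^+ 5 = quinticN v * quinticM v * rrdisc.
Proof.
apply: (@fps_mulfI _ (E25 ^+ 6 * (G ^+ 5 * quinticP v))).
  rewrite fcoef0M (fcoef0X E25) fcoef0M (fcoef0X G) !fcoef_compXn0 fcoef_poch0.
  by rewrite fcoef_rrfracV0 fcoef_quinticP0 !expr1n !mulr1 oner_neq0.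
have dissectionE : G - X - X ^+ 2 * F = G * quinticP v.
  rewrite /quinticP; ring: compXn5_rrfracVK.
have normE : G ^+ 5 - 11 * X ^+ 5 - X ^+ 10 * F ^+ 5 =
    G ^+ 5 * (quinticP v * quinticN v * quinticM v).
  rewrite quinticPNM; ring: compXn5_rrfracVK.
transitivity (poch K 1 1 ^+ 6);
  first by rewrite poch11_dissection dissectionE; ring.
rewrite poch11_exp6 poch55_exp6 normE; ring.
Qed.

(* The other root [- G M / (X^2 N)] of the quadratic equation is not a power
   series. *)
Lemma quinticM_rrfrac_exp5 : quinticM v * f ^+ 5 = F * quinticN v.
Proof.
apply/subr0_eq.
apply: (@fps_mulfI _ (G * quinticM v + X ^+ 2 * quinticN v * f ^+ 5)).
  rewrite fcoefD fcoef0M fcoef_compXn0 fcoef_rrfracV0 fcoef_quinticM0 -!mulrA.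
  by rewrite fcoef0M mul0r addr0 mulr1 oner_neq0.
have := quinticP_rrdisc; rewrite quinticP_exp5 /rrdisc => quadratic.
rewrite mulr0.
transitivity ((G * (quinticM v ^+ 2 - 11 * v * quinticM v * quinticN v -
      v ^+ 2 * quinticN v ^+ 2) -
    quinticN v * quinticM v * (g ^+ 5 - 11 * X - X ^+ 2 * f ^+ 5)) * f ^+ 5).
  move: (quinticM v) (quinticN v) => M N.
  ring: compXn5_rrfracVK (rrfracVK K).
by rewrite quadratic subrr mul0r.
Qed.

Lemma compXn5_rrdisc_rrfrac :
  compXn 5 (rrdisc * f ^+ 5) = quinticP v * quinticN v * quinticM v.
Proof.
have -> : rrdisc * f ^+ 5 = 1 - 11 * (X * f ^+ 5) - (X * f ^+ 5) ^+ 2.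
  rewrite /rrdisc; ring: (rrfracVK K).
rewrite quinticPNM !compXnB compXn1 (compXnM _ 11) (rmorph_nat (compXn 5)) /=.
rewrite (rmorphXn (compXn 5)) /= compXnM (rmorphXn (compXn 5)) /=
  compXnX //; ring.
Qed.

Lemma rrfrac_exp5 :
  f ^+ 5 = compXn 5 (e ^+ 6 * g ^+ 4) * (quinticP v * quinticN v ^+ 2).
Proof.
have -> : quinticP v * quinticN v ^+ 2 =
    compXn 5 (rrdisc * f ^+ 5) * f ^+ 5 * G.
  rewrite compXn5_rrdisc_rrfrac; move: quinticM_rrfrac_exp5.
  move: (quinticP v) (quinticN v) (quinticM v) => P N M MfE.
  ring: MfE compXn5_rrfracVK.
have : compXn 5 (e ^+ 6 * g ^+ 4) * compXn 5 (rrdisc * f ^+ 5) = F.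
  rewrite -compXnM; congr compXn; ring: (rrfracVK K) regular5_exp6.
move: (compXn 5 _) (compXn 5 _) => U V UVF; ring: UVF compXn5_rrfracVK.
Qed.

Lemma rrfracV_exp5 :
  g ^+ 5 = compXn 5 (e ^+ 6 * g ^+ 6) * (quinticP v * quinticM v ^+ 2).
Proof.
have quinticME : quinticM v = quinticN v * F * g ^+ 5.
  rewrite (mulrC (quinticN v)) -quinticM_rrfrac_exp5; ring: (rrfracVK K).
have -> : quinticP v * quinticM v ^+ 2 =
    compXn 5 (rrdisc * f ^+ 5) * g ^+ 5 * F.
  rewrite expr2 {2}quinticME compXn5_rrdisc_rrfrac; ring.
have : compXn 5 (e ^+ 6 * g ^+ 6) * compXn 5 (rrdisc * f ^+ 5) = G.
  rewrite -compXnM; congr compXn; ring: (rrfracVK K) regular5_exp6.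
move: (compXn 5 _) (compXn 5 _) => U V UVG.
ring: UVG compXn5_rrfracVK.
Qed.

Lemma msect_quinticPN2 :
  msect 5 0 (quinticP v * quinticN v ^+ 2) =
  1 - 36 * (f ^+ 5 * X) - f ^+ 10 * X ^+ 2.
Proof.
rewrite quinticPN2 msect_sum_compXn // big_mkcond !big_ord_recr big_ord0 /=.
ring.
Qed.

Lemma msect_quinticPM2 :
  msect 5 0 (quinticP v * quinticM v ^+ 2) =
  1 - 36 * (f ^+ 5 * X) - f ^+ 10 * X ^+ 2.
Proof.
rewrite quinticPM2 msect_sum_compXn // big_mkcond !big_ord_recr big_ord0 /=.
ring.
Qed.

Lemma msect1_quinticPM2 :
  msect 5 1 (quinticP v * quinticM v ^+ 2) = 5 * f - 40 * (f ^+ 6 * X).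
Proof.
rewrite quinticPM2 msect_sum_compXn // big_mkcond !big_ord_recr big_ord0 /=.
ring.
Qed.

Lemma msect_rrfrac_exp5 : msect 5 0 (f ^+ 5) = f - (X * (f * e ^+ 6)) *+ 25.
Proof.
rewrite rrfrac_exp5 msect_compXnM // msect_quinticPN2.
transitivity (e ^+ 6 * rrdisc * f - (X * (f * e ^+ 6)) *+ 25).
  rewrite /rrdisc; ring: (rrfracVK K).
by rewrite regular5_exp6 mul1r.
Qed.

Lemma msect_rrfracV_exp5 : msect 5 0 (g ^+ 5) = g - (X * (g * e ^+ 6)) *+ 25.
Proof.
rewrite rrfracV_exp5 msect_compXnM // msect_quinticPM2.
transitivity (e ^+ 6 * rrdisc * g - (X * (g * e ^+ 6)) *+ 25).
  rewrite /rrdisc; ring: (rrfracVK K).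
by rewrite regular5_exp6 mul1r.
Qed.

Lemma msect_rrfrac_rrfracV_exp5 : msect 5 1 (F * g ^+ 5) =
  f *+ 5 + (X * (f * e ^+ 6)) *+ 15 + (X ^+ 2 * (f * e) ^+ 6) *+ 5.
Proof.
rewrite msect_compXnM // rrfracV_exp5 msect_compXnM // msect1_quinticPM2.
transitivity ((e ^+ 6 * rrdisc * f) *+ 5 + (X * (f * e ^+ 6)) *+ 15 +
    (X ^+ 2 * (f * e) ^+ 6) *+ 5).
  rewrite /rrdisc; ring: (rrfracVK K).
by rewrite regular5_exp6 mul1r.
Qed.

End QuinticRelation.

(** * The coefficientwise order *)

Definition fps_le (K : numDomainType) (f g : fps K) :=
  forall n, fcoef f n <= fcoef g n.

Notation "f <=c g" := (fps_le f g) (at level 70).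

Section CoefficientwiseOrder.
Variable K : numDomainType.
Local Notation X := (fpsX K).
Implicit Types f g h t : fps K.

Lemma fps_le_trans f g h : f <=c g -> g <=c h -> f <=c h.
Proof. by move=> fg gh n; apply: le_trans (fg n) (gh n). Qed.

Lemma fps_subr_ge0 f g : 0 <=c g - f <-> f <=c g.
Proof. by split=> fg n; have := fg n; rewrite fcoefB fcoef0 subr_ge0. Qed.

Lemma fps_ge0P f : 0 <=c f <-> forall n, 0 <= fcoef f n.
Proof. by split=> f0 n; have := f0 n; rewrite fcoef0. Qed.

Lemma fps_ge0D f g : 0 <=c f -> 0 <=c g -> 0 <=c f + g.
Proof.
by move=> /fps_ge0P f0 /fps_ge0P g0; apply/fps_ge0P => n; apply: addr_ge0.
Qed.

Lemma fps_ge0M f g : 0 <=c f -> 0 <=c g -> 0 <=c f * g.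
Proof.
move=> /fps_ge0P f0 /fps_ge0P g0; apply/fps_ge0P => n.
by rewrite fcoefM sumr_ge0 // => i _; apply: mulr_ge0.
Qed.

Lemma fps_le_wpM2l h f g : 0 <=c h -> f <=c g -> h * f <=c h * g.
Proof.
by move=> h0 /fps_subr_ge0 fg; apply/fps_subr_ge0; rewrite -mulrBr;
  apply: fps_ge0M.
Qed.

Lemma fps_le01 : 0 <=c (1 : fps K).
Proof. by move=> n; rewrite fcoef0 fcoef1 ler0n. Qed.

Lemma fps_ge1_ge0 f : 1 <=c f -> 0 <=c f.
Proof. exact: fps_le_trans fps_le01. Qed.

Lemma fps_ler_peMl f g : 1 <=c f -> 0 <=c g -> g <=c f * g.
Proof.
by move=> f1 g0; rewrite -{1}[g]mulr1 [f * g]mulrC; apply: fps_le_wpM2l.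
Qed.

Lemma fps_ge1M f g : 1 <=c f -> 1 <=c g -> 1 <=c f * g.
Proof.
move=> f1 g1; apply: (fps_le_trans g1).
exact: fps_ler_peMl f1 (fps_ge1_ge0 g1).
Qed.

Lemma fps_ge1X f n : 1 <=c f -> 1 <=c f ^+ n.
Proof. by move=> f1; elim: n => [//|n IHn]; rewrite exprS; apply: fps_ge1M. Qed.

Lemma fpsXn_ge0 n : 0 <=c X ^+ n.
Proof. by move=> k; rewrite fcoef0 fcoefXn ler0n. Qed.

Lemma fps_le_limit (u v : nat -> fps K) f g :
  (forall N, eqmodX N.+1 f (u N)) -> (forall N, eqmodX N.+1 g (v N)) ->
  (forall N, u N <=c v N) -> f <=c g.
Proof.
move=> fu gv uv n; rewrite (fu n n (ltnSn n)) (gv n n (ltnSn n)).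
exact: uv.
Qed.

Definition dominated f g := f <=c g /\ - f <=c g.

Lemma dominated_refl f : 0 <=c f -> dominated f f.
Proof.
by move=> /fps_ge0P f0; split=> // n; rewrite fcoefN ge0_cp.
Qed.

Lemma dominated_limit (u v : nat -> fps K) f g :
  (forall N, eqmodX N.+1 f (u N)) -> (forall N, eqmodX N.+1 g (v N)) ->
  (forall N, dominated (u N) (v N)) -> dominated f g.
Proof.
move=> fu gv uv; split=> n;
  rewrite ?fcoefN (fu n n (ltnSn n)) (gv n n (ltnSn n)).
  exact: (uv n).1.
exact: (uv n).2.
Qed.

Lemma dominatedM f g f' g' :
  dominated f g -> dominated f' g' -> dominated (f * f') (g * g').
Proof.
have half_ge0 h : 0 <=c h *+ 2 -> 0 <=c h.
  move=> /fps_ge0P h0; apply/fps_ge0P => n.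
  by have := h0 n; rewrite fcoefMn pmulrn_lge0.
move=> [/fps_subr_ge0 gf /fps_subr_ge0 g_f]
  [/fps_subr_ge0 gf' /fps_subr_ge0 g_f'].
rewrite !opprK in g_f g_f'; split; apply/fps_subr_ge0/half_ge0; rewrite ?opprK.
  have -> : (g * g' - f * f') *+ 2 =
      (g - f) * (g' + f') + (g + f) * (g' - f') by ring.
  by apply: fps_ge0D; apply: fps_ge0M.
have -> : (g * g' + f * f') *+ 2 =
    (g - f) * (g' - f') + (g + f) * (g' + f') by ring.
by apply: fps_ge0D; apply: fps_ge0M.
Qed.

Lemma dominated_1BXn m : (0 < m)%N -> dominated (1 - X ^+ m) (geo K m).
Proof.
move=> m0; suff coefE n : `|(n == 0%N)%:R - (n == m)%:R| <= (m %| n)%:R :> K.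
  split=> n; rewrite ?fcoefN fcoefB fcoefXn fcoef1 /=;
    apply: le_trans (coefE n).
    by rewrite real_ler_norm // rpredB // realn.
  by rewrite -normrN real_ler_norm // rpredN rpredB // realn.
have [->|n0] := eqVneq n 0%N; first by rewrite (ltn_eqF m0) subr0 dvdn0 normr1.
have [->|nm] := eqVneq n m; first by rewrite sub0r normrN normr1 dvdnn.
by rewrite subr0 normr0 ler0n.
Qed.

Lemma dominated_prod (u v : nat -> fps K) N :
  (forall k, dominated (u k) (v k)) ->
  dominated (\prod_(k < N) u k) (\prod_(k < N) v k).
Proof.
move=> uv; elim/big_ind2: _ => [|f g f' g'|//];
  first exact: dominated_refl fps_le01.
exact: dominatedM.
Qed.

Lemma dominated_poch a b : (0 < a)%N -> (0 < b)%N ->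
  dominated (poch K a b) (pochV K a b).
Proof.
move=> a0 b0.
apply: dominated_limit (fun N => eqmodX_poch _ a0 b0)
  (fun N => eqmodX_pochV _ a0 b0) _.
have factors k : dominated (1 - X ^+ (a + b * k)) (geo K (a + b * k)).
  by apply: dominated_1BXn; lia.
by move=> N; apply: (dominated_prod N factors).
Qed.

Lemma geo_ge1 m : 1 <=c geo K m.
Proof. by move=> [|n]; rewrite fcoef1 /= ?dvdn0 ?ler0n. Qed.

Lemma pochV_ge1 a b : (0 < a)%N -> (0 < b)%N -> 1 <=c pochV K a b.
Proof.
move=> a0 b0.
apply: fps_le_limit (fun N => @eqmodX_refl _ _ 1)
  (fun N => eqmodX_pochV _ a0 b0) _.
move=> N; elim/big_ind: _ => [//|f g|i _]; first exact: fps_ge1M.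
exact: geo_ge1.
Qed.

Lemma pochV_recl a b : (0 < a)%N -> (0 < b)%N ->
  pochV K a b = geo K a * pochV K (a + b) b.
Proof.
move=> a0 b0; have ab0 : (0 < a + b)%N by lia.
apply: eqmodX_eq => N.
apply: eqmodX_trans (eqmodX_leq (leqnSn _) (@eqmodX_pochV K a b N.+1 a0 b0)) _.
apply/eqmodX_sym; rewrite big_ord_recl muln0 addn0; apply: eqmodXM => //.
rewrite (eq_bigr (fun k : 'I_N => geo K (a + b + b * k)));
  first exact: eqmodX_pochV.
by move=> k _; rewrite /= /bump /= mulnDr muln1 addnA.
Qed.

Lemma geo_le_pochV a b : (0 < a)%N -> (0 < b)%N -> geo K a <=c pochV K a b.
Proof.
move=> a0 b0; rewrite pochV_recl // mulrC; apply: fps_ler_peMl.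
  by apply: pochV_ge1; rewrite ?addn_gt0 ?a0.
exact/fps_ge1_ge0/geo_ge1.
Qed.

(* For the generating series [f] of a family of partitions and [t] of their
   possible parts: deleting a part of each nonempty partition gives
   [f <=c 1 + t * f]. *)
Definition part_bounded t f := [/\ 0 <=c t, 1 <=c f & f <=c 1 + t * f].

Lemma part_boundedM t f t' f' :
  part_bounded t f -> part_bounded t' f' -> part_bounded (t + t') (f * f').
Proof.
move=> [t0 f1 tf] [t0' f1' tf']; split; [exact: fps_ge0D|exact: fps_ge1M|].
apply/fps_subr_ge0; have -> : 1 + (t + t') * (f * f') - f * f' =
  (1 + t * f - f) + (t * f) * (f' - 1) + f * (1 + t' * f' - f') by ring.
move/fps_subr_ge0: tf => tf; move/fps_subr_ge0: tf' => tf'.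
have f0 := fps_ge1_ge0 f1; move/fps_subr_ge0: f1' => f1'.
apply: fps_ge0D (fps_ge0M f0 tf'); apply: (fps_ge0D tf).
exact: fps_ge0M (fps_ge0M t0 f0) f1'.
Qed.

Lemma geoS m : (0 < m)%N -> geo K m = 1 + X ^+ m * geo K m.
Proof. by move=> m0; rewrite -(mul1BXn_geo K m0); ring. Qed.

Lemma part_bounded_geo m : (0 < m)%N -> part_bounded (X ^+ m) (geo K m).
Proof.
move=> m0; split; [exact: fpsXn_ge0|exact: geo_ge1|].
by rewrite -geoS.
Qed.

Lemma part_bounded_prod (m : nat -> nat) N : (forall k, 0 < m k)%N ->
  part_bounded (\sum_(k < N) X ^+ m k) (\prod_(k < N) geo K (m k)).
Proof.
move=> m0; elim: N => [|N IHN]; last first.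
  by rewrite !big_ord_recr /=; apply: part_boundedM => //;
    apply: part_bounded_geo.
by rewrite !big_ord0; split=> // n; rewrite mul0r addr0.
Qed.

Lemma geo_sum a b N : (0 < b)%N ->
  X ^+ a * geo K b = \sum_(k < N) X ^+ (a + b * k) + X ^+ (a + b * N) * geo K b.
Proof.
move=> b0; elim: N => [|N IHN]; first by rewrite big_ord0 add0r muln0 addn0.
rewrite IHN big_ord_recr /= {1}geoS // mulrDr mulr1 addrA mulrA -exprD.
by rewrite -addnA -mulnSr.
Qed.

Lemma part_bounded_pochV a b : (0 < a)%N -> (0 < b)%N ->
  part_bounded (X ^+ a * geo K b) (pochV K a b).
Proof.
move=> a0 b0; have geo0 m : 0 <=c geo K m := fps_ge1_ge0 (@geo_ge1 m).
split; [apply: fps_ge0M (fpsXn_ge0 a) (geo0 b)|exact: pochV_ge1|].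
apply: (@fps_le_limit _
  (fun N => 1 + X ^+ a * geo K b * \prod_(k < N) geo K (a + b * k))
  _ _ (fun N => eqmodX_pochV _ a0 b0)).
  by move=> N; do ![apply: eqmodXD => //|apply: eqmodXM => //];
    apply: eqmodX_pochV.
move=> N; have abk k : (0 < a + b * k)%N by lia.
have [_ prod_ge1 prod_le] := part_bounded_prod N abk.
apply: (fps_le_trans prod_le); rewrite (geo_sum a N b0); apply/fps_subr_ge0.
rewrite [X in 0 <=c X](_ : _ = X ^+ (a + b * N) * geo K b *
  \prod_(k < N) geo K (a + b * k)); last by ring.
by do !apply: fps_ge0M; [exact: fpsXn_ge0|exact: geo0|exact: fps_ge1_ge0].
Qed.

Lemma geo_split m : (0 < m)%N -> geo K 1 = (\sum_(i < m) X ^+ i) * geo K m.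
Proof.
move=> m0; apply: (@fps_mulfI _ (1 - X)).
  by rewrite fcoefB fcoef1 subr0 oner_neq0.
have sumE : (1 - X) * \sum_(i < m) X ^+ i = 1 - X ^+ m.
  by rewrite -opprB mulNr -subrX1 opprB.
by rewrite mulrA sumE mul1BXn_geo // -{1}(expr1 X) mul1BXn_geo.
Qed.

Lemma regular5_ge1 : 1 <=c regular5 K.
Proof. by do !apply: fps_ge1M; apply: pochV_ge1. Qed.

Lemma geo1_le_regular5 : geo K 1 <=c regular5 K.
Proof.
apply: (fps_le_trans (@geo_le_pochV 1 5 isT isT)).
rewrite /regular5 -!mulrA mulrC; apply: fps_ler_peMl.
  by do !apply: fps_ge1M; apply: pochV_ge1.
exact/fps_ge1_ge0/pochV_ge1.
Qed.

Lemma regular5_le : regular5 K <=c 1 + X * geo K 1 * regular5 K.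
Proof.
have [t0 e1 e_le] : part_bounded
    (X ^+ 1 * geo K 5 + X ^+ 2 * geo K 5 + X ^+ 3 * geo K 5 + X ^+ 4 * geo K 5)
    (regular5 K).
  by do !apply: part_boundedM; apply: part_bounded_pochV.
apply: (fps_le_trans e_le); rewrite (@geo_split 5) //; apply/fps_subr_ge0.
rewrite !big_ord_recr big_ord0
  [X in 0 <=c X](_ : _ = X ^+ 5 * geo K 5 * regular5 K).
  apply: fps_ge0M (fps_ge1_ge0 e1).
  exact: fps_ge0M (fpsXn_ge0 5) (fps_ge1_ge0 (@geo_ge1 5)).
by rewrite /=; ring.
Qed.

Lemma regular5_coefS_le n :
  fcoef (regular5 K) n.+1 <= fcoef (geo K 1 * regular5 K) n.
Proof.
have := regular5_le n.+1; rewrite fcoefD fcoef1 add0r -mulrA.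
by rewrite fcoefXM.
Qed.

Lemma geo1_regular5_gt0 n : 0 < fcoef (geo K 1 * regular5 K) n.
Proof.
have geo_le : geo K 1 <=c geo K 1 * regular5 K.
  rewrite mulrC; apply: fps_ler_peMl regular5_ge1 _.
  exact/fps_ge1_ge0/geo_ge1.
by apply: lt_le_trans (geo_le n); rewrite /= dvd1n ltr01.
Qed.

Lemma dominated_pochV a b : (0 < a)%N -> (0 < b)%N ->
  dominated (pochV K a b) (pochV K a b).
Proof. by move=> a0 b0; apply/dominated_refl/fps_ge1_ge0/pochV_ge1. Qed.

Lemma dominated_rrfrac : dominated (rrfrac K) (regular5 K).
Proof.
have -> : regular5 K = pochV K 1 5 * pochV K 4 5 * (pochV K 2 5 * pochV K 3 5).
  rewrite /regular5; ring.
by do !apply: dominatedM; by [apply: dominated_poch|apply: dominated_pochV].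
Qed.

Lemma dominated_rrfracV : dominated (rrfracV K) (regular5 K).
Proof.
have -> : regular5 K = pochV K 2 5 * pochV K 3 5 * (pochV K 1 5 * pochV K 4 5).
  rewrite /regular5; ring.
by do !apply: dominatedM; by [apply: dominated_poch|apply: dominated_pochV].
Qed.

Lemma rrfrac_regular5_ge1 : 1 <=c rrfrac K * regular5 K.
Proof.
rewrite rrfrac_regular5; apply: fps_ge1X; apply: fps_ge1M; exact: pochV_ge1.
Qed.

Lemma rrfracV_regular5_ge1 : 1 <=c rrfracV K * regular5 K.
Proof.
rewrite rrfracV_regular5; apply: fps_ge1X; apply: fps_ge1M; exact: pochV_ge1.
Qed.

Lemma geo1_regular5_le h : 1 <=c h * regular5 K ->
  geo K 1 * regular5 K <=c h * regular5 K ^+ 6.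
Proof.
move=> he1; have e0 := fps_ge1_ge0 regular5_ge1.
have -> : h * regular5 K ^+ 6 =
    h * regular5 K * regular5 K ^+ 3 * (regular5 K * regular5 K) by ring.
apply: (@fps_le_trans _ (regular5 K * regular5 K)).
  by rewrite [geo K 1 * _]mulrC; apply: fps_le_wpM2l e0 geo1_le_regular5.
apply: fps_ler_peMl; last exact: fps_ge0M.
exact/fps_ge1M/fps_ge1X/regular5_ge1.
Qed.

Lemma coef_sub25_lt0 h n : dominated h (regular5 K) -> 1 <=c h * regular5 K ->
  fcoef (h - (X * (h * regular5 K ^+ 6)) *+ 25) n.+1 < 0.
Proof.
move=> [h_le _] he1; rewrite fcoefB fcoefMn fcoefXM subr_lt0.
apply: le_lt_trans (le_trans (h_le n.+1) (regular5_coefS_le n)) _.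
have S_gt0 := geo1_regular5_gt0 n.
apply: lt_le_trans (ler_wMn2r 25 (geo1_regular5_le he1 n)).
by rewrite -[ltLHS]mulr1n ltr_pMn2l.
Qed.

Lemma coef_add15_gt0 h t n : dominated h (regular5 K) -> 1 <=c h * regular5 K ->
  0 < fcoef h 0 -> 0 <=c t ->
  0 < fcoef (h *+ 5 + (X * (h * regular5 K ^+ 6)) *+ 15 + t) n.
Proof.
move=> [_ h_le] he1 h0 /fps_ge0P t0.
rewrite (fcoefD _ t) ltr_pwDl // fcoefD !fcoefMn fcoefXM.
case: n => [|n]; first by rewrite mul0rn addr0 pmulrn_lgt0.
have := le_trans (h_le n.+1) (regular5_coefS_le n).
have := geo1_regular5_le he1 n; have := geo1_regular5_gt0 n.
rewrite fcoefN lerNl; move: (fcoef (geo K 1 * _) n) => S S_gt0 S_le S_ge.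
apply: lt_le_trans (lerD (ler_wMn2r 5 S_ge) (ler_wMn2r 15 S_le)).
by rewrite (_ : _ + _ = S *+ 10) ?pmulrn_lgt0 //; ring.
Qed.

End CoefficientwiseOrder.

Section Signs.
Variable K : numClosedFieldType.

Lemma rrfrac_exp5_lt0 n : fcoef (rrfrac K ^+ 5) (5 * n.+1) < 0.
Proof.
rewrite -[(5 * n.+1)%N]addn0 -fcoef_msect msect_rrfrac_exp5.
exact: coef_sub25_lt0 (dominated_rrfrac K) (rrfrac_regular5_ge1 K).
Qed.

Lemma rrfracV_exp5_lt0 n : fcoef (rrfracV K ^+ 5) (5 * n.+1) < 0.
Proof.
rewrite -[(5 * n.+1)%N]addn0 -fcoef_msect msect_rrfracV_exp5.
exact: coef_sub25_lt0 (dominated_rrfracV K) (rrfracV_regular5_ge1 K).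
Qed.

Lemma compXn5_rrfrac_rrfracV_exp5_gt0 n :
  0 < fcoef (compXn 5 (rrfrac K) * rrfracV K ^+ 5) (5 * n + 1).
Proof.
rewrite -fcoef_msect msect_rrfrac_rrfracV_exp5.
apply: coef_add15_gt0 (dominated_rrfrac K) (rrfrac_regular5_ge1 K) _ _.
  by rewrite fcoef_rrfrac0 ltr01.
have fe_ge0 := fps_ge1_ge0 (fps_ge1X 6 (rrfrac_regular5_ge1 K)).
have /fps_ge0P tail_ge0 := fps_ge0M (fpsXn_ge0 K 2) fe_ge0.
by apply/fps_ge0P => k; rewrite fcoefMn mulrn_wge0.
Qed.

End Signs.

(** * Asymptotic expansions at 0 *)

Local Open Scope classical_set_scope.

Section AsymptoticExpansions.
Variable K : numFieldType.
Implicit Types (f g : fps K) (F G : K -> K) (p : {poly K}) (N : nat).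

Definition bigO_Xn N F := F =O_ ((0 : K)^') (fun q : K => q ^+ N).

Lemma bigO_XnP N F : bigO_Xn N F <->
  exists2 C : K, 0 < C & \forall q \near (0 : K)^', `|F q| <= C * `|q| ^+ N.
Proof.
rewrite /bigO_Xn eqO_exP; split=> -[C C0 FC]; exists C => //.
  by apply: filterS FC => q; rewrite normrX.
by apply: filterS FC => q; rewrite normrX.
Qed.

Lemma bigO_XnD N F G : bigO_Xn N F -> bigO_Xn N G -> bigO_Xn N (F + G).
Proof. by rewrite /bigO_Xn => -> ->; rewrite addO. Qed.

Lemma bigO_XnM M N F G : bigO_Xn M F -> bigO_Xn N G -> bigO_Xn (M + N) (F * G).
Proof.
move=> /bigO_XnP[C C0 FC] /bigO_XnP[D D0 GD]; apply/bigO_XnP.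
exists (C * D); first exact: mulr_gt0.
near=> q; rewrite normrM exprD mulrACA; apply: ler_pM => //.
  by near: q.
by near: q.
Unshelve. all: by end_near. Qed.

Lemma bigO_XnN N F : bigO_Xn N F -> bigO_Xn N (- F).
Proof. by rewrite /bigO_Xn => ->; rewrite oppO. Qed.

Lemma bigO_XnW M N F : (M <= N)%N -> bigO_Xn N F -> bigO_Xn M F.
Proof.
move=> MN /bigO_XnP[C C0 FC]; apply/bigO_XnP; exists C => //.
near=> q; have q1 : `|q| <= 1 by near: q; exact: dnbhs0_le.
have : `|F q| <= C * `|q| ^+ N by near: q.
by move=> /le_trans; apply; rewrite ler_wpM2l ?(ltW C0) // ler_wiXn2l.
Unshelve. all: by end_near. Qed.

Lemma near0_mul_norm_lt (C e : K) : 0 < C -> 0 < e ->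
  \forall q \near (0 : K)^', C * `|q| < e.
Proof.
move=> C0 e0; have := @dnbhs0_lt K K (e / C) (divr_gt0 e0 C0).
by apply: filterS => q; rewrite ltr_pdivlMr // mulrC.
Qed.

Lemma bigO_horner N p : (forall i, (i < N)%N -> p`_i = 0) ->
  bigO_Xn N (horner p).
Proof.
move=> p0; apply/bigO_XnP; exists (1 + \sum_(i < size p) `|p`_i|).
  by rewrite ltr_pwDl // sumr_ge0.
near=> q; have q1 : `|q| <= 1 by near: q; exact: dnbhs0_le.
rewrite horner_coef; apply: le_trans (ler_norm_sum _ _ _) _.
rewrite mulrDl mul1r ler_wpDl ?exprn_ge0 // mulr_suml; apply: ler_sum => i _.
rewrite normrM normrX; have [iN|Ni] := ltnP i N;
  first by rewrite p0 // normr0 !mul0r.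
by rewrite ler_wpM2l // ler_wiXn2l.
Unshelve. all: by end_near. Qed.

Lemma bigO_cst_eq0 N (c : K) : bigO_Xn N.+1 (fun=> c) -> c = 0.
Proof.
move=> /bigO_XnP[C C0 cC]; apply/eqP; apply: contraT; rewrite -normr_gt0 => c0.
have norm_le1 : \forall q \near (0 : K)^', `|q| <= 1 by apply: dnbhs0_le.
have [q [[cq Cq] q1]] :=
  filter_ex (filterI (filterI cC (near0_mul_norm_lt C0 c0)) norm_le1).
suff : `|c| < `|c| by rewrite ltxx.
apply: le_lt_trans cq (le_lt_trans _ Cq); rewrite ler_wpM2l ?(ltW C0) //.
by rewrite exprS ler_piMr // exprn_ile1.
Qed.

Lemma bigO_horner_coef_eq0 N p : bigO_Xn N (horner p) ->
  forall i, (i < N)%N -> p`_i = 0.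
Proof.
elim: N p => // N IHN p pO; pose r := drop_poly 1 p.
have pE q : p.[q] = p`_0 + q * r.[q].
  suff -> : p.[q] = ((p`_0)%:P + 'X * r).[q] by rewrite !hornerE.
  congr (_.[q]); apply/polyP => -[|i]; rewrite coefD coefC coefXM ?addr0 //=.
  by rewrite add0r coef_drop_poly addn1.
have p0 : p`_0 = 0.
  apply: (@bigO_cst_eq0 0).
  rewrite [X in bigO_Xn _ X](_ : _ = horner p + - horner ('X * r)).
    apply: bigO_XnD (bigO_XnW (ltn0Sn N) pO) (bigO_XnN (bigO_horner _)).
    by case=> // _; rewrite coefXM.
  by apply/funext => q; rewrite /= !fctE pE !hornerE addrK.
have rO : bigO_Xn N (horner r).
  have /bigO_XnP[C C0 pC] := pO; apply/bigO_XnP; exists C => //; near=> q.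
  have q0 : 0 < `|q| by rewrite normr_gt0; near: q; apply: nbhs_dnbhs_neq.
  rewrite -(ler_pM2l q0) -normrM mulrCA -exprS.
  have -> : q * r.[q] = p.[q] by rewrite pE p0 add0r.
  by near: q.
by case=> [//|i] iN; have := IHN r rO i iN; rewrite coef_drop_poly addn1.
Unshelve. all: by end_near. Qed.

Definition expands f F :=
  forall N, bigO_Xn N (fun q => F q - (fps_trunc N f).[q]).

Lemma expands_near f F G : (\forall q \near (0 : K)^', F q = G q) ->
  expands f F -> expands f G.
Proof.
move=> FG fF N; have /bigO_XnP[C C0 FC] := fF N; apply/bigO_XnP; exists C => //.
by near=> q; have <- : F q = G q; near: q.
Unshelve. all: by end_near. Qed.

Lemma expands_bigO1 f F : expands f F -> bigO_Xn 0 F.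
Proof.
move=> /(_ 0%N); rewrite /fps_trunc poly_def big_ord0.
by under eq_fun do rewrite horner0 subr0.
Qed.

Lemma expands_unique f g F : expands f F -> expands g F -> f = g.
Proof.
move=> fF gF; apply: fpsP => n; apply/eqP.
rewrite -subr_eq0 -!(@coef_fps_trunc _ n.+1) //.
rewrite -coefB; apply/eqP; apply: (@bigO_horner_coef_eq0 n.+1) => //.
have -> : horner (fps_trunc n.+1 f - fps_trunc n.+1 g) =
    (fun q => F q - (fps_trunc n.+1 g).[q]) +
    - (fun q => F q - (fps_trunc n.+1 f).[q]).
  by apply/funext => q;
    rewrite hornerD hornerN !fctE opprB [RHS]addrC addrA subrK.
by apply: bigO_XnD (gF _) (bigO_XnN (fF _)).
Qed.

Lemma expandsM f g F G : expands f F -> expands g G ->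
  expands (f * g) (fun q => F q * G q).
Proof.
move=> fF gG N; pose tf := fps_trunc N f; pose tg := fps_trunc N g.
have -> : (fun q => F q * G q - (fps_trunc N (f * g)).[q]) =
    (fun q => F q - tf.[q]) * G + horner tf * (fun q => G q - tg.[q]) +
    horner (tf * tg - fps_trunc N (f * g)).
  by apply/funext => q; rewrite !fctE hornerD hornerN hornerM; ring.
apply: bigO_XnD; last first.
  apply: bigO_horner => i iN; rewrite coefB coef_fps_trunc //.
  by rewrite -(fcoef_mul_trunc _ _ iN) subrr.
apply: bigO_XnD.
  by have := bigO_XnM (fF N) (expands_bigO1 gG); rewrite addn0.
have tf_bounded : bigO_Xn 0 (horner tf) by apply: bigO_horner.
exact: bigO_XnM tf_bounded (gG N).
Qed.

Lemma expandsX f F n : expands f F ->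
  expands (f ^+ n.+1) (fun q => F q ^+ n.+1).
Proof.
move=> fF; elim: n => [|n IHn]; first exact: fF.
by rewrite exprS; under eq_fun do rewrite exprS; apply: expandsM.
Qed.

Lemma expands_neq0 f F : expands f F -> fcoef f 0 != 0 ->
  \forall q \near (0 : K)^', F q != 0.
Proof.
move=> /(_ 1%N)/bigO_XnP[C C0 FC]; rewrite -normr_gt0 => f0.
near=> q; have : `|F q - (fps_trunc 1 f).[q]| <= C * `|q| ^+ 1 by near: q.
rewrite /fps_trunc poly_def big_ord1 expr0 hornerZ hornerC mulr1 expr1.
apply: contraTneq => ->; rewrite sub0r normrN; apply/negP => f0_le.
have : `|fcoef f 0| < `|fcoef f 0|; last by rewrite ltxx.
by apply: le_lt_trans f0_le _; near: q; apply: near0_mul_norm_lt.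
Unshelve. all: by end_near. Qed.

Lemma expands_div f g h F G : fcoef g 0 != 0 -> expands g G ->
  expands (g * h) F -> expands f (fun q => F q / G q) -> f = h.
Proof.
move=> g0 gG ghF fFG; apply: (fps_mulfI g0); apply: expands_unique ghF.
rewrite mulrC; apply: expands_near (expandsM fFG gG).
by apply: filterS (expands_neq0 gG g0) => q Gq0; rewrite divfK.
Qed.

Lemma geometric_lim_dist_le (u : nat -> K) (l C x : K) N :
  0 <= x -> 2 * x <= 1 ->
  (forall n, `|u n.+1 - u n| <= C * x ^+ n) -> u @ \oo --> l ->
  `|l - u N| <= 2 * C * x ^+ N.
Proof.
move=> x0 x2 uC ul; have C0 : 0 <= C.
  by have := le_trans (normr_ge0 _) (uC 0%N); rewrite expr0 mulr1.
have tail m : `|u (N + m)%N - u N| <= 2 * C * x ^+ N - 2 * C * x ^+ (N + m).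
  elim: m => [|m IHm]; first by rewrite addn0 !subrr normr0.
  rewrite addnS; set n := (N + m)%N in IHm *.
  rewrite (_ : u n.+1 - u N = (u n.+1 - u n) + (u n - u N));
    last by rewrite addrA subrK.
  apply: le_trans (ler_normD _ _) (le_trans (lerD (uC n) IHm) _).
  rewrite -subr_ge0 (_ : _ - _ = C * x ^+ n * (1 - 2 * x));
    last by rewrite exprS; ring.
  by rewrite !mulr_ge0 ?exprn_ge0 ?subr_ge0.
apply/ler_addgt0Pl => e e0.
have [M _ /(_ (N + M)%N (leq_addl _ _)) lu] :
    \forall n \near \oo, `|l - u n| < e.
  by move/cvgrPdist_lt: ul; apply.
rewrite (_ : l - u N = l - u (N + M)%N + (u (N + M)%N - u N));
  last by rewrite addrA subrK.
apply: le_trans (ler_normD _ _) (lerD (ltW lu) _).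
apply: le_trans (tail M) _; rewrite lerBlDr lerDl mulr_ge0 ?exprn_ge0 //.
by rewrite mulr_ge0.
Qed.

Lemma expands_geometric f F (u : nat -> K -> K) (C M : K) : 0 < C -> 0 < M ->
  (forall N, bigO_Xn N (fun q => u N q - (fps_trunc N f).[q])) ->
  (\forall q \near (0 : K)^', u^~ q @ \oo --> F q) ->
  (\forall q \near (0 : K)^', forall n,
     `|u n.+1 q - u n q| <= C * (M * `|q|) ^+ n) ->
  expands f F.
Proof.
move=> C0 M0 uf uF uC N.
have -> : (fun q => F q - (fps_trunc N f).[q]) =
    (fun q => F q - u N q) + (fun q => u N q - (fps_trunc N f).[q]).
  by apply/funext => q; rewrite !fctE addrA subrK.
apply: bigO_XnD (uf N); apply/bigO_XnP; exists (2 * C * M ^+ N).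
  by rewrite !mulr_gt0 ?exprn_gt0.
have twoM0 : 0 < 2 * M by rewrite mulr_gt0.
near=> q; rewrite -mulrA -exprMn; apply: (@geometric_lim_dist_le (u^~ q)).
- by rewrite mulr_ge0 // ltW.
- by rewrite mulrA; apply/ltW; near: q; exact: near0_mul_norm_lt twoM0 ltr01.
- by near: q.
by near: q.
Unshelve. all: by end_near. Qed.

Lemma qexpansion_expands (c : nat -> int) F :
  is_qexpansion c F -> expands (Fps (fun n => (c n)%:~R)) F.
Proof.
move=> cF; have half0 : 0 < 2^-1 :> K by rewrite invr_gt0.
have half1 : `|2^-1 : K| < 1 by rewrite gtr0_norm // invf_lt1 // ltr1n.
have /cvgP/cvg_seq_bounded/pinfty_ex_gt0[B B0 /= sumB] := cF _ half1.
have cB n : `|(c n)%:~R : K| <= (B + B) * 2 ^+ n.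
  have := lerD (sumB n.+1 I) (sumB n I).
  rewrite /= => /(le_trans (ler_normB _ _)).
  rewrite /series /= big_nat_recr //= addrAC subrr add0r normrM normrX.
  by rewrite (gtr0_norm half0) exprVn ler_pdivrMr ?exprn_gt0.
pose partial n (q : K) := series (fun n => (c n)%:~R * q ^+ n) n.
apply: (@expands_geometric _ _ partial (B + B) 2).
- exact: addr_gt0.
- by [].
- move=> N; rewrite [X in bigO_Xn _ X](_ : _ = horner 0).
    by apply: bigO_horner => i _; rewrite coef0.
  by apply/funext => q;
    rewrite horner0 horner_poly /partial /series /= big_mkord subrr.
- by apply: filterS (dnbhs0_lt ltr01) => q; apply: cF.
near=> q => n; rewrite /partial /series /= big_nat_recr //= addrAC subrr add0r.
by rewrite normrM normrX exprMn mulrA ler_wpM2r // exprn_ge0.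
Unshelve. all: by end_near. Qed.

Definition fps_of_poly p : fps K := Fps (fun n => p`_n).

Lemma fps_of_polyB : {morph fps_of_poly : p r / p - r}.
Proof. by move=> p r; apply: fpsP => n; rewrite fcoefB /= coefB. Qed.

Lemma fps_of_polyM : {morph fps_of_poly : p r / p * r}.
Proof. by move=> p r; apply: fpsP => n; rewrite /= coefM. Qed.

Lemma fps_of_poly1 : fps_of_poly 1 = 1.
Proof. by apply: fpsP => n; rewrite fcoef1 /= coef1. Qed.

Lemma fps_of_polyXn n : fps_of_poly 'X^n = fpsX K ^+ n.
Proof. by apply: fpsP => k; rewrite fcoefXn /= coefXn. Qed.

Definition qpoch_partial a b n (q : K) :=
  \prod_(k < n) (1 - q ^+ a * (q ^+ b) ^+ k).

Lemma qpoch_partial_bigO a b N : (0 < a)%N -> (0 < b)%N ->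
  bigO_Xn N (fun q => qpoch_partial a b N q - (fps_trunc N (poch K a b)).[q]).
Proof.
move=> a0 b0; pose p : {poly K} := \prod_(k < N) (1 - 'X^(a + b * k)).
have coef_p i : (i < N)%N -> p`_i = fcoef (poch K a b) i.
  move=> iN; rewrite (@eqmodX_poch K a b N a0 b0 i (ltnW iN)).
  rewrite -[LHS]/(fcoef (fps_of_poly p) i)
    (big_morph _ fps_of_polyM fps_of_poly1).
  by under eq_bigr do rewrite fps_of_polyB fps_of_poly1 fps_of_polyXn.
rewrite [X in bigO_Xn _ X](_ : _ = horner (p - fps_trunc N (poch K a b))).
  by apply: bigO_horner => i iN;
    rewrite coefB coef_p // coef_fps_trunc // subrr.
apply/funext => q; rewrite hornerD hornerN horner_prod; congr (_ - _).
by apply: eq_bigr => k _; rewrite !hornerE -exprM -exprD.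
Qed.

Lemma qpoch_partial_step a b n (q : K) : (0 < b)%N -> `|q| <= 1 ->
  `|qpoch_partial a b n.+1 q - qpoch_partial a b n q| <= 1 * (2 * `|q|) ^+ n.
Proof.
move=> b0 q1.
rewrite /qpoch_partial big_ord_recr /= mulrBr mulr1 addrAC subrr add0r.
rewrite normrN normrM mul1r exprMn -exprM -exprD normrX; apply: ler_pM => //.
  rewrite normr_prod -[in leRHS](card_ord n) -prodr_const.
  apply: ler_prod => k _.
  rewrite normr_ge0 (le_trans (ler_normB _ _)) // normr1 -exprM -exprD normrX.
  by rewrite -[leRHS]/(1 + 1) lerD2l exprn_ile1.
by rewrite ler_wiXn2l //; nia.
Qed.

Lemma expands_qpoch a b : (0 < a)%N -> (0 < b)%N ->
  (\forall q \near (0 : K)^', cvg (qpoch_partial a b ^~ q @ \oo)) ->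
  expands (poch K a b) (fun q => qpoch (q ^+ a) (q ^+ b)).
Proof.
move=> a0 b0 partial_cvg.
apply: (@expands_geometric _ _ (qpoch_partial a b) 1 2) => //.
  by move=> N; apply: qpoch_partial_bigO.
by near=> q => n; apply: qpoch_partial_step => //; near: q; exact: dnbhs0_le.
Unshelve. all: by end_near. Qed.

End AsymptoticExpansions.

Local Open Scope complex_scope.

(** * Convergence over the complex numbers *)

Section ComplexConvergence.
Variable R : realType.
Local Notation K := (R[i] : numFieldType).
Implicit Types (z : R[i]) (u : nat -> K).

Lemma norm_real_complex (x : R) : `|x%:C| = `|x|%:C :> R[i].
Proof. by rewrite normc_def /= expr0n /= addr0 sqrtr_sqr. Qed.

Lemma complex_gt0P (e : R[i]) : 0 < e -> exists2 x : R, 0 < x & e = x%:C.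
Proof. by case: e => x y; rewrite ltcE /= => /andP[/eqP -> x0]; exists x. Qed.

Lemma norm_Im_le z : `|complex.Im z|%:C <= `|z|.
Proof. by rewrite normc_def lecR -sqrtr_sqr ler_wsqrtr // lerDr sqr_ge0. Qed.

Lemma norm_le_ReIm z : `|z| <= (`|complex.Re z| + `|complex.Im z|)%:C.
Proof.
rewrite {1}[z]complexE; apply: le_trans (ler_normD _ _) _.
rewrite rmorphD /= normrM !norm_real_complex (_ : `|'i%C| = 1) ?mul1r //.
by rewrite normc_def /= expr0n expr1n /= add0r sqrtr1.
Qed.

Lemma complex_cvg u (a b : R) :
  (fun n => complex.Re (u n)) @ \oo --> a ->
  (fun n => complex.Im (u n)) @ \oo --> b -> u @ \oo --> (a +i* b : K).
Proof.
move=> ua ub; apply/cvgrPdist_lt => _ /complex_gt0P[e e0 ->].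
have e2 : 0 < e / 2 by rewrite divr_gt0.
near=> n; apply: le_lt_trans (norm_le_ReIm _) _; rewrite ltcR [e]splitr !raddfB.
by apply: ltrD; near: n;
  [move/cvgrPdist_lt: ua; apply|move/cvgrPdist_lt: ub; apply].
Unshelve. all: by end_near. Qed.

Lemma real_geometric_is_cvg (x : nat -> R) (c : R) :
  (forall n, `|x n.+1 - x n| <= c * 2^-1 ^+ n) -> cvg (x @ \oo).
Proof.
move=> xc; have half1 : `|2^-1 : R| < 1.
  by rewrite ger0_norm // invf_lt1 // ltr1n.
have /normed_cvg tele_cvg : cvgn [normed series (telescope x)].
  apply: (@series_le_cvg _ (fun n => `|telescope x n|) (geometric c 2^-1))
    => // [n|].
    exact: le_trans (xc n).
  exact: is_cvg_geometric_series.
rewrite (_ : x = (fun n => x 0%N + series (telescope x) n)).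
  by apply: is_cvgD => //; apply: is_cvg_cst.
by apply/funext => n; apply: eq_sum_telescope.
Qed.

Lemma complex_geometric_is_cvg u (c : R) :
  (forall n, `|u n.+1 - u n| <= (c * 2^-1 ^+ n)%:C) -> cvg (u @ \oo).
Proof.
move=> uc.
have /cvg_ex[a ua] : cvg ((fun n => complex.Re (u n)) @ \oo).
  apply: (@real_geometric_is_cvg _ c) => n; rewrite -lecR -raddfB.
  exact: le_trans (normc_ge_Re _) (uc n).
have /cvg_ex[b ub] : cvg ((fun n => complex.Im (u n)) @ \oo).
  apply: (@real_geometric_is_cvg _ c) => n; rewrite -lecR -raddfB.
  exact: le_trans (norm_Im_le _) (uc n).
by apply/cvg_ex; exists (a +i* b); apply: complex_cvg.
Qed.

Lemma expands_qpoch_complex a b : (0 < a)%N -> (0 < b)%N ->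
  expands (poch K a b) (fun q => qpoch (q ^+ a) (q ^+ b)).
Proof.
move=> a0 b0; apply: expands_qpoch => //; near=> q.
have q4 : 4 * `|q| <= 1.
  by apply/ltW; near: q; apply: near0_mul_norm_lt.
have q1 : `|q| <= 1 by near: q; exact: dnbhs0_le.
apply: (@complex_geometric_is_cvg _ 1) => n.
apply: le_trans (qpoch_partial_step a n b0 q1) _.
rewrite !mul1r rmorphXn fmorphV rmorph_nat lerXn2r ?nnegrE ?mulr_ge0
  ?invr_ge0 //.
by rewrite -(ler_pM2l (ltr0n K 2)) mulfV ?pnatr_eq0 // mulrA -natrM.
Unshelve. all: by end_near. Qed.

End ComplexConvergence.

Section ProductExpansions.
Variable R : realType.
Local Notation K := (R[i] : numFieldType).
Local Notation "'P_' a" := (poch K a 5) (at level 2, a at level 1).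

Lemma expands_qpoch_exp5M a b : (0 < a)%N -> (0 < b)%N ->
  expands (P_ a ^+ 5 * P_ b ^+ 5)
    (fun q => qpoch (q ^+ a) (q ^+ 5) ^+ 5 * qpoch (q ^+ b) (q ^+ 5) ^+ 5).
Proof.
by move=> a0 b0; apply: expandsM; apply: expandsX; apply: expands_qpoch_complex.
Qed.

Lemma qexpansion_rrfracV_exp5 (A : nat -> int) :
  is_qexpansion A (fun q : K =>
     (qpoch (q ^+ 2) (q ^+ 5) ^+ 5 * qpoch (q ^+ 3) (q ^+ 5) ^+ 5)
     / (qpoch q (q ^+ 5) ^+ 5 * qpoch (q ^+ 4) (q ^+ 5) ^+ 5)) ->
  Fps (fun n => (A n)%:~R) = rrfracV K ^+ 5.
Proof.
move/qexpansion_expands.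
apply: expands_div (@expands_qpoch_exp5M 1 4 isT isT) _.
  by rewrite fcoef_poch_exp5M0 oner_neq0.
by rewrite poch_exp5M_rrfracV; apply: expands_qpoch_exp5M.
Qed.

Lemma qexpansion_rrfrac_exp5 (B : nat -> int) :
  is_qexpansion B (fun q : K =>
     (qpoch q (q ^+ 5) ^+ 5 * qpoch (q ^+ 4) (q ^+ 5) ^+ 5)
     / (qpoch (q ^+ 2) (q ^+ 5) ^+ 5 * qpoch (q ^+ 3) (q ^+ 5) ^+ 5)) ->
  Fps (fun n => (B n)%:~R) = rrfrac K ^+ 5.
Proof.
move/qexpansion_expands.
apply: expands_div (@expands_qpoch_exp5M 2 3 isT isT) _.
  by rewrite fcoef_poch_exp5M0 oner_neq0.
by rewrite poch_exp5M_rrfrac; apply: (@expands_qpoch_exp5M 1 4).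
Qed.

Lemma qexpansion_compXn5_rrfrac_rrfracV_exp5 (D : nat -> int) :
  is_qexpansion D (fun q : K =>
     (qpoch (q ^+ 5) (q ^+ 25) * qpoch (q ^+ 20) (q ^+ 25))
     / (qpoch (q ^+ 10) (q ^+ 25) * qpoch (q ^+ 15) (q ^+ 25))
     * ((qpoch (q ^+ 2) (q ^+ 5) ^+ 5 * qpoch (q ^+ 3) (q ^+ 5) ^+ 5)
        / (qpoch q (q ^+ 5) ^+ 5 * qpoch (q ^+ 4) (q ^+ 5) ^+ 5))) ->
  Fps (fun n => (D n)%:~R) = compXn 5 (rrfrac K) * rrfracV K ^+ 5.
Proof.
move/qexpansion_expands => D_expands.
have compE a b : (0 < a)%N -> (0 < b)%N ->
    compXn 5 (P_ a * P_ b) = poch K (5 * a) 25 * poch K (5 * b) 25.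
  by move=> a0 b0; rewrite compXnM !compXn_poch.
have comp_expands a b : (0 < a)%N -> (0 < b)%N ->
    expands (compXn 5 (P_ a * P_ b))
    (fun q => qpoch (q ^+ (5 * a)) (q ^+ 25) * qpoch (q ^+ (5 * b)) (q ^+ 25)).
  move=> a0 b0; rewrite (compE a b a0 b0).
  by apply: expandsM; apply: expands_qpoch_complex; rewrite ?muln_gt0.
have den0 : fcoef (compXn 5 (P_ 2 * P_ 3) * (P_ 1 ^+ 5 * P_ 4 ^+ 5)) 0 != 0.
  rewrite fcoef0M fcoef_poch_exp5M0 compE // fcoef0M !fcoef_poch0.
  by rewrite !mulr1 oner_neq0.
have den_expands :=
  expandsM (@comp_expands 2 3 isT isT) (@expands_qpoch_exp5M 1 4 isT isT).
apply: expands_div den0 den_expands _ (expands_near _ D_expands).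
  rewrite poch_exp5M_compXn5_rrfrac.
  exact: expandsM (@comp_expands 1 4 isT isT)
    (@expands_qpoch_exp5M 2 3 isT isT).
by near=> q; rewrite mulf_div.
Unshelve. all: by end_near. Qed.

End ProductExpansions.

Theorem theorem1 (R : realType) (A B D : nat -> int)
  (hA : is_qexpansion (K := R[i]) A (fun q =>
     (qpoch (q ^+ 2) (q ^+ 5) ^+ 5 * qpoch (q ^+ 3) (q ^+ 5) ^+ 5)
     / (qpoch q (q ^+ 5) ^+ 5 * qpoch (q ^+ 4) (q ^+ 5) ^+ 5)))
  (hB : is_qexpansion (K := R[i]) B (fun q =>
     (qpoch q (q ^+ 5) ^+ 5 * qpoch (q ^+ 4) (q ^+ 5) ^+ 5)
     / (qpoch (q ^+ 2) (q ^+ 5) ^+ 5 * qpoch (q ^+ 3) (q ^+ 5) ^+ 5)))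
  (hD : is_qexpansion (K := R[i]) D (fun q =>
     (qpoch (q ^+ 5) (q ^+ 25) * qpoch (q ^+ 20) (q ^+ 25))
     / (qpoch (q ^+ 10) (q ^+ 25) * qpoch (q ^+ 15) (q ^+ 25))
     * ((qpoch (q ^+ 2) (q ^+ 5) ^+ 5 * qpoch (q ^+ 3) (q ^+ 5) ^+ 5)
        / (qpoch q (q ^+ 5) ^+ 5 * qpoch (q ^+ 4) (q ^+ 5) ^+ 5)))) :
  [/\ forall n : nat, (1 <= n)%N -> A (5 * n)%N < 0,
      forall n : nat, (1 <= n)%N -> B (5 * n)%N < 0 &
      forall n : nat, 0 < D (5 * n + 1)%N].
Proof.
split=> [[//|n] _|[//|n] _|n].
- rewrite -(ltrz0 R[i]) -[_%:~R]/(fcoef (Fps (fun n => (A n)%:~R)) _).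
  by rewrite (qexpansion_rrfracV_exp5 hA) rrfracV_exp5_lt0.
- rewrite -(ltrz0 R[i]) -[_%:~R]/(fcoef (Fps (fun n => (B n)%:~R)) _).
  by rewrite (qexpansion_rrfrac_exp5 hB) rrfrac_exp5_lt0.
rewrite -(ltr0z R[i]) -[_%:~R]/(fcoef (Fps (fun n => (D n)%:~R)) _).
rewrite (qexpansion_compXn5_rrfrac_rrfracV_exp5 hD).
exact: compXn5_rrfrac_rrfracV_exp5_gt0.
Qed.
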